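(* Given a communicating ADMDP with state space $S$, action space $A$ and period $\gamma$, the regret of the algorithm $\mathcal{A}_2$ described in the context (following the cycle chosen by an FPL subroutine, and spending $\gamma d$ steps to catch the new cycle at each switch) is bounded by $$\text{Regret}\le O\left(|S|^3\cdot\gamma\sqrt{L^*\cdot\log(|S||A|)}\right),$$ where $L^*$ is the total loss incurred by the best stationary deterministic policy in hindsight.
   Context: **ADMDP.** An ADMDP (deterministic MDP with adversarial losses) consists of a finite state space $S$, a finite action space $A$ and a deterministic transition map $N:S\times A\to S$, known to the learner. It is represented by the directed graph $G$ on $S$ with an edge $(s,a,N(s,a))$ for every $(s,a)$. It is communicating if $G$ is strongly connected. The period of a vertex is the gcd of the lengths of all cycles starting and ending at it; in a strongly connected graph all vertices have the same period $\gamma$. The vertices are then partitioned into $\gamma$ non-empty cycle classes, each edge going from a class to the next one cyclically. The critical length $d$ of $G$ is a value such that for every integer $\ell\ge d$ there is a path of length $\gamma\ell$ from any state to any other state in the same cycle class; $d$ is at most $O(|S|^2)$. **Protocol.** An oblivious adversary fixes in advance loss functions $\ell_1,\dots,\ell_T:S\times A\to[0,1]$. The interaction starts in an arbitrary state $s_1$. At each step $t=1,\dots,T$ the learner in state $s_t$ chooses $a_t$, incurs $\ell_t(s_t,a_t)$, then the whole function $\ell_t$ is revealed (full information), and $s_{t+1}=N(s_t,a_t)$. For a stationary deterministic policy $\pi:S\to A$, $L^\pi$ is the total loss over the $T$ steps when $\pi$ is followed from $s_1$; $L^*=\min_\pi L^\pi$ over such policies. The regret of an algorithm is $\mathbb{E}[\sum_{t=1}^T\ell_t(s_t,a_t)]-L^*$.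 **Cycles.** $\mathcal{C}_{(s,k)}$ is the set of closed walks of length $k$ in $G$ starting at $s$ (sequences of edges). A cycle is an element of $\mathcal{C}_{(s,k)}$ with $1\le k\le|S|$ and $s$ in the same cycle class as the start state of the environment; $k(c)$ is the length of $c$. $s_t(c)$ is the state reached after following $c$ (repeatedly) for $t-1$ steps from the start of the interaction and $a_t(c)$ is the action taken by $c$ in step $t$. **FPL subroutine $\mathcal{A}_1$.** Sample perturbation vectors $\epsilon_i\in\mathbb{R}^{|S||A|}$ ($1\le i\le|S|$) and $\delta\in\mathbb{R}^{|S|^2}$ with independent entries from an exponential distribution with parameter $\lambda$. At time $t$ it chooses a cycle $C_t$ attaining $$\min_{s,\,k,\,c\in\mathcal{C}_{(s,k)}}\ \delta(s,k)+\sum_{i=1}^{t-1}\ell_i(s_i(c),a_i(c))+\sum_{i=1}^{k(c)}\epsilon_i(s_i(c),a_i(c)),$$ keeping the previous cycle if it is still a minimizer. The parameter is $\lambda=\min\left(\sqrt{\log(|S||A|)/\Lambda},\,1/(4|S|)\right)$, where $\Lambda$ is the cumulative loss of the best cycle in hindsight. **Algorithm $\mathcal{A}_2$.** Let $c_1$ be the cycle chosen by $\mathcal{A}_1$ at $t=1$. If $s_1$ is not the start state of $c_1$, spend $\gamma d$ steps to move to the state in which $c_1$ (followed from the start of the interaction) would be at the time of arrival. Then follow the current cycle $c_t$, choosing $a_t=a_t(c_t)$, and feed each revealed $\ell_t$ to $\mathcal{A}_1$. Whenever $\mathcal{A}_1$ switches to a new cycle $c_{t+1}$ and the current state $s_{t+1}$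 differs from $s_{t+1}(c_{t+1})$, spend $\gamma d$ steps to move to the state in which $c_{t+1}$ would be at the time of arrival, and then follow $c_{t+1}$; if $s_{t+1}=s_{t+1}(c_{t+1})$, follow $c_{t+1}$ immediately.
   Formalization: The exponential perturbations are subtracted from, not added to, the cumulative loss in the FPL subroutine (with added noise the bound fails already for one state and many actions), and the O-bound is asserted for L* ≥ |S|² log(|S||A|), since it fails at L* = 0. *)

(* Defs.v *)
From HB Require Import structures.
From mathcomp Require Import all_boot all_order all_algebra.
From mathcomp Require Import all_classical all_reals all_analysis.

Set Implicit Arguments.
Unset Strict Implicit.
Unset Printing Implicit Defensive.

Import Order.TTheory GRing.Theory Num.Theory.

Local Open Scope classical_set_scope.
Local Open Scope ring_scope.

(* Time is 0-based throughout: the library index t stands for step t + 1, so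
   loss t, C t, learner ... t are the objects of step t + 1.
   An edge (s, a, N s a) is determined by (s, a); a walk from s is therefore
   given by its sequence of actions w, and it ends at foldl N s w. *)

Section Graph.
Context {S A : finType}.
Variable N : S -> A -> S.

Definition communicating : Prop :=
  forall u v, connect (fun x y => [exists a, N x a == y]) u v.

Definition closed_walk_length (s : S) (n : nat) : Prop :=
  exists w : seq A, size w = n /\ foldl N s w = s.

Definition period_at (s : S) (g : nat) : Prop :=
  (forall n, closed_walk_length s n -> (g %| n)%N) /\
  (forall e, (forall n, closed_walk_length s n -> (e %| n)%N) -> (e %| g)%N).

Definition graph_period (g : nat) : Prop := forall s, period_at s g.

Definition cyclic_classes (g : nat) (cls : S -> 'I_g) : Prop :=
  (forall i, exists s, cls s = i) /\
  (forall s a, cls (N s a) = ((cls s).+1 %% g)%N :> nat).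

(* The target may be the source itself; walks may have length 0. *)
Definition reaches_class_from (g : nat) (cls : S -> 'I_g) (d : nat) : Prop :=
  forall l, (d <= l)%N -> forall u v, cls u = cls v ->
  exists w : seq A, size w = (g * l)%N /\ foldl N u w = v.

(* Every d' >= d has the property as soon as d has it, so the critical length
   is the least such value. *)
Definition critical_length (g : nat) (cls : S -> 'I_g) (d : nat) : Prop :=
  reaches_class_from cls d /\
  (forall d', reaches_class_from cls d' -> (d <= d')%N).

Definition policy_state (s1 : S) (p : S -> A) (t : nat) : S :=
  iter t (fun s => N s (p s)) s1.

End Graph.

(* Candidate walks of length 1, ..., #|S|: tag c is the length minus 1, and
   tagged c is the start state together with the actions. *)
Definition walk (S A : finType) : finType :=
  {k : 'I_#|S| & (S * k.+1.-tuple A)%type}.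

Section Cycles.
Context {S A : finType}.
Variable N : S -> A -> S.

Definition walk_len (c : walk S A) : nat := (tag c).+1.
Definition walk_start (c : walk S A) : S := (tagged c).1.
Definition walk_acts (c : walk S A) : seq A := (tagged c).2.

Definition is_cycle (g : nat) (cls : S -> 'I_g) (s1 : S) (c : walk S A) : bool :=
  (foldl N (walk_start c) (walk_acts c) == walk_start c) &&
  (cls (walk_start c) == cls s1).

Definition cycle_state (c : walk S A) (t : nat) : S :=
  foldl N (walk_start c) (take (t %% walk_len c) (walk_acts c)).

Definition cycle_action (c : walk S A) (t : nat) : A :=
  tnth (tagged c).2 (inord (t %% walk_len c)).

End Cycles.

Section Losses.
Context {R : realType} {S A : finType}.
Variables (N : S -> A -> S) (s1 : S) (loss : nat -> S -> A -> R) (T : nat).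

Definition policy_loss (p : {ffun S -> A}) : R :=
  \sum_(t < T) loss t (policy_state N s1 p t) (p (policy_state N s1 p t)).

(* These infima are over finite sets, hence minima. *)
Definition best_policy_loss : R := inf (range policy_loss).

Definition cycle_loss (c : walk S A) (n : nat) : R :=
  \sum_(i < n) loss i (cycle_state N c i) (cycle_action c i).

Definition best_cycle_loss (g : nat) (cls : S -> 'I_g) : R :=
  inf [set cycle_loss c T | c in [set c | is_cycle N cls s1 c]].

(* For best_cycle_loss = 0 the first term of the minimum is +oo, whereas
   division by 0 yields 0 here. *)
Definition fpl_rate (g : nat) (cls : S -> 'I_g) : R :=
  let L := best_cycle_loss cls in
  let cap := 1 / (4 * #|S|%:R) in
  if L == 0 then cap
  else Num.min (Num.sqrt (ln (#|S| * #|A|)%:R / L)) cap.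

End Losses.

(* inl (s, k) indexes delta (s, k + 1); inr (i, (s, a)) indexes
   epsilon_(i + 1) (s, a). *)
Definition noise_index (S A : finType) : finType :=
  ((S * 'I_#|S|) + ('I_#|S| * (S * A)))%type.

(* The factors B i = setT recover the product rule for all subfamilies. *)
Definition independent_RVs d (Omega : measurableType d) (R : realType)
    (P : probability Omega R) (I : finType) (Z : I -> {RV P >-> R}) : Prop :=
  forall B : I -> set R, (forall i, measurable (B i)) ->
    (P (\bigcap_(i in [set: I]) (Z i @^-1` B i)) =
     \prod_(i : I) P (Z i @^-1` B i))%E.

Definition exponential_RV d (Omega : measurableType d) (R : realType)
    (P : probability Omega R) (rate : R) (X : {RV P >-> R}) : Prop :=
  forall V : set R, measurable V -> distribution P X V = exponential_prob rate V.

Section Algorithms.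
Context {R : realType} {S A : finType}.
Variables (N : S -> A -> S) (s1 : S) (loss : nat -> S -> A -> R) (T : nat).
Variables (g : nat) (cls : S -> 'I_g).

(* The one-sided exponential perturbation enters with a minus sign, so that
   memorylessness makes the leader stable: it is the leader because its noise
   exceeds a threshold.  With a plus sign and a minimum it would be the leader
   because its noise lies below a threshold; already for #|S| = 1 and losses
   hitting the K actions in turn, the regret is then about
   (K - 1) / 2 * sqrt (Lstar * ln K), so no O(sqrt (Lstar * ln K)) holds. *)
Definition perturbed_loss (z : noise_index S A -> R) (t : nat)
    (c : walk S A) : R :=
  cycle_loss N loss c t
  - (z (inl (walk_start c, tag c)) +
     \sum_(i < #|S| | (i < walk_len c)%N)
        z (inr (i, (cycle_state N c i, cycle_action c i)))).

Definition is_leader (z : noise_index S A -> R) (t : nat) (c : walk S A) : Prop :=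
  is_cycle N cls s1 c /\
  forall c', is_cycle N cls s1 c' -> perturbed_loss z t c <= perturbed_loss z t c'.

(* Ties other than with the previous cycle are broken arbitrarily. *)
Definition fpl_run (z : noise_index S A -> R) (C : nat -> walk S A) : Prop :=
  (forall t, (t < T)%N -> is_leader z t (C t)) /\
  (forall t, (t.+1 < T)%N -> is_leader z t.+1 (C t) -> C t.+1 = C t).

(* route x y is the way used to go from x to y in exactly m steps. *)
Definition catching_route (m : nat) (route : S -> S -> seq A) : Prop :=
  forall x y, cls x = cls y -> size (route x y) = m /\ foldl N x (route x y) = y.

Section Learner.
Variables (m : nat) (route : S -> S -> seq A) (C : nat -> walk S A).

(* The pair is the current state and the catch-up actions still to be played.
   A switch during a catch-up replaces it by a catch-up of the new cycle. *)
Definition plan (t : nat) (xp : S * seq A) : seq A :=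
  let: (x, p) := xp in
  if (t == 0%N) || (C t != C t.-1) then
    if x == cycle_state N (C t) t then [::]
    else route x (cycle_state N (C t) (t + m))
  else p.

Definition next_action (t : nat) (xp : S * seq A) : A :=
  head (cycle_action (C t) t) (plan t xp).

Fixpoint learner (t : nat) : S * seq A :=
  if t is u.+1 then
    (N (learner u).1 (next_action u (learner u)), behead (plan u (learner u)))
  else (s1, [::]).

Definition learner_loss : R :=
  \sum_(t < T) loss t (learner t).1 (next_action t (learner t)).

End Learner.
End Algorithms.

(* Main.v *)
(* The leader C t minimises the loss so far minus the noise on the coordinates
   the cycle uses. If the leader c is dethroned by c' after a step of loss p,
   then c uses a coordinate j that c' does not use; with all other coordinates
   fixed, c leads exactly when z_j exceeds some threshold v, and it can be
   overtaken by a cycle not using j only if z_j < v + p. By memorylessness this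
   has probability at most rate * p times that of c leading, so summing over
   the at most #|S| + 1 coordinates of c the expected number e of switches is
   at most (#|S| + 1) * rate * f, where f is the expected loss of the leaders.
   Be-the-leader gives f <= Lam + E[noise of a cycle] + e + 1, with Lam the loss
   of the best cycle and E[noise] = O(#|S| ln(#|S| #|A|) / rate). Each switch
   costs gamma * d <= gamma * #|S|^2 steps of catching up, and a policy agrees
   with a cycle after #|S| steps, whence Lam <= Lstar + #|S|. *)

From HB Require Import structures.
Require Import Defs.
From mathcomp Require Import all_boot all_order all_algebra.
From mathcomp Require Import all_classical all_reals all_analysis.
From mathcomp Require Import measurable_realfun.
From mathcomp Require Import ring lra zify.

Set Implicit Arguments.
Unset Strict Implicit.

Import Order.TTheory GRing.Theory Num.Theory.

Local Open Scope classical_set_scope.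
Local Open Scope ring_scope.

(** * Walk lengths *)

(** Cutting out loops leaves a walk that visits each state at most once. *)
Lemma walk_shorten (S A : finType) (N : S -> A -> S) (u : S) (w : seq A) :
  exists w' : seq A, (size w' < #|S|)%N /\ foldl N u w' = foldl N u w.
Proof.
pose e := [rel x y | [exists a, N x a == y]].
have path_walk p : forall x, path e x p ->
    exists w' : seq A, size w' = size p /\ foldl N x w' = last x p.
  elim: p => [|y p IH] x /=; first by exists [::].
  case/andP => /existsP[a /eqP ay] /IH[w' [sz fw]].
  by exists (a :: w'); rewrite /= sz ay.
have : connect e u (foldl N u w).
  elim: w u => [|a w IH] x //=.
  apply: connect_trans (IH _); apply: connect1; apply/existsP; by exists a.
case/connectP => p /shortenP[p' ep' up' _] ->.
have [w' [sz fw]] := path_walk _ _ ep'.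
exists w'; split => //; rewrite sz.
by rewrite -[(size p').+1]/(size (u :: p')) -(card_uniqP up') max_card.
Qed.

Lemma foldl_class (S A : finType) (N : S -> A -> S) (g : nat) (cls : S -> 'I_g)
    (u : S) (w : seq A) :
  cyclic_classes N cls -> cls (foldl N u w) = ((cls u + size w) %% g)%N :> nat.
Proof.
case=> _ step; elim: w u => [|a w IH] u /=.
  by rewrite addn0 modn_small.
by rewrite IH step modnDml addSnnS.
Qed.

Lemma closed_walk_length_mul (S A : finType) (N : S -> A -> S) (u : S) (m k : nat) :
  closed_walk_length N u m -> closed_walk_length N u (k * m)%N.
Proof.
move=> [w [sz fw]]; elim: k => [|k [w' [sz' fw']]]; first by exists [::].
by exists (w ++ w'); rewrite size_cat foldl_cat fw sz sz' mulSn.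
Qed.

Lemma closed_walk_length_add (S A : finType) (N : S -> A -> S) (u : S) (m k : nat) :
  closed_walk_length N u m -> closed_walk_length N u k ->
  closed_walk_length N u (m + k)%N.
Proof.
move=> [w [sz fw]] [w' [sz' fw']].
by exists (w ++ w'); rewrite size_cat foldl_cat fw sz sz'.
Qed.

(* The residues of the closed walk lengths form a subgroup of Z/h, hence
   consist of the multiples of their least positive representative e; then e
   divides every closed walk length, hence the period. *)
Lemma closed_walk_residue (S A : finType) (N : S -> A -> S) (u : S) (g h : nat) :
  period_at N u g -> (0 < h)%N -> closed_walk_length N u h ->
  exists m, closed_walk_length N u m /\ m = g %[mod h].
Proof.
move=> [_ gmax] h0 Lh.
pose Q e := (0 < e)%N /\ exists m, closed_walk_length N u m /\ m = e %[mod h].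
have exQ : exists e, `[< Q e >].
  by exists h; apply/asboolP; split => //; exists h.
case: (ex_minnP exQ) => e /asboolP[e0 [m [Lm me]]] emin.
have : (e %| g)%N.
  apply: gmax => n Ln; apply: contraT => ne.
  have r0 : (0 < n %% e)%N by rewrite lt0n.
  have : `[< Q (n %% e)%N >].
    apply/asboolP; split => //.
    (* Modulo [h], [h.-1] acts as [-1] and [m] as [e], so this length has the residue of
       [n - n %/ e * e], that is [n %% e]. *)
    exists (n + (n %/ e * h.-1) * m)%N; split.
      by apply: closed_walk_length_add => //; apply: closed_walk_length_mul.
    rewrite -modnDmr -modnMmr me modnMmr modnDmr {1}(divn_eq n e).
    rewrite (_ : _ + _ = n %/ e * e * h + n %% e)%N ?modnMDl //.
    by case: h h0 {Lh Q exQ emin me} => // h _ /=; lia.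
  by move/emin; rewrite leqNgt ltn_pmod.
case/dvdnP => k ->; exists (k * m)%N; split; first exact: closed_walk_length_mul.
by rewrite -modnMmr me modnMmr.
Qed.

(* Walks whose length has a prescribed residue modulo h are walks in the
   product of the graph with Z/h; a shortest one is then padded with copies of
   a closed walk of length h at the source. *)
Lemma reaches_class_sq (S A : finType) (N : S -> A -> S) (g : nat)
    (cls : S -> 'I_g) (a0 : A) :
  communicating N -> graph_period N g -> cyclic_classes N cls ->
  reaches_class_from N cls (#|S| ^ 2).
Proof.
move=> com per cyc l ln u v clsuv.
have walkP x y : exists w : seq A, foldl N x w = y.
  case/connectP: (com x y) => p + ->; elim: p x => [|z p IH] x /=.
    by exists [::].
  by case/andP => /existsP[a /eqP az] /IH[w fw]; exists (a :: w); rewrite /= az.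
have g0 : (0 < g)%N by case: (cls u) => i /=; case: (g).
(* One edge out of [u], then a loop-free walk back: fewer than [#|S|] further steps. *)
have [h [h0 hn [wh [szh fh]]]] :
    exists h, [/\ (0 < h)%N, (h <= #|S|)%N & closed_walk_length N u h].
  have [w fw] := walkP (N u a0) u.
  have [w' [sz fw']] := walk_shorten N (N u a0) w.
  exists (size w').+1; split => //.
  by exists (a0 :: w'); rewrite /= fw' fw.
have [m [Lm mg]] := closed_walk_residue (per u) h0
  (ex_intro _ wh (conj szh fh)).
have [w0 fw0] := walkP u v.
have gw0 : (g %| size w0)%N.
  have := foldl_class u w0 cyc; rewrite fw0 -clsuv => /eqP.
  rewrite -{1}(modn_small (ltn_ord (cls u))) -{1}[nat_of_ord (cls u)]addn0.
  by rewrite eqn_modDl mod0n eq_sym.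
have [w1 [szw1 fw1]] : exists w1 : seq A, size w1 = g * l %[mod h] /\
    foldl N u w1 = v.
  case/dvdnP: gw0 => q szw0.
  (* As [m] is [g] and [h.-1] is [-1] modulo [h], these copies contribute [g * l - q * g]; the
     length [q * g] of [w0] restores [g * l]. *)
  have [w2 [sz2 fw2]] := closed_walk_length_mul (l + q * h.-1) Lm.
  exists (w2 ++ w0); rewrite foldl_cat fw2 fw0 size_cat sz2 szw0; split => //.
  rewrite -modnDml -modnMmr mg modnMmr modnDml.
  rewrite (_ : _ + _ = q * g * h + g * l)%N ?modnMDl //.
  by case: h h0 {hn szh mg w2 sz2 fw2} => // h _ /=; lia.
case: h h0 hn szh mg szw1 => // h _ hn szh mg szw1.
pose N2 (x : S * 'I_h.+1) (a : A) : S * 'I_h.+1 := (N x.1 a, inord (x.2.+1 %% h.+1)).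
have N2E w x : foldl N2 x w = (foldl N x.1 w, inord ((x.2 + size w) %% h.+1)).
  elim: w x => [|a w IH] [x i] /=.
    by rewrite addn0 modn_small // inord_val.
  by rewrite IH /= inordK ?ltn_pmod // modnDml addSnnS.
have [w' [szw']] := walk_shorten N2 (u, ord0) w1.
rewrite !N2E /= fw1 !add0n => -[fw' /(congr1 val)].
rewrite /= !inordK ?ltn_pmod // szw1 => mw'.
(* A loop-free walk in the product has fewer than [#|S| * h.+1 <= #|S| ^ 2] steps. The missing
   length is a multiple of [h.+1] and is filled by loops at [u]. *)
have le : (size w' <= g * l)%N.
  apply: leq_trans (ltnW szw') _; rewrite card_prod card_ord.
  apply: leq_trans (leq_mul (leqnn _) hn) _; rewrite mulnn.
  by apply: leq_trans ln _; rewrite leq_pmull.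
have /dvdnP[q qE] : (h.+1 %| g * l - size w')%N by rewrite -eqn_mod_dvd // mw'.
have [w3 [sz3 fw3]] := closed_walk_length_mul q
  (ex_intro _ wh (conj szh fh)).
exists (w3 ++ w'); rewrite size_cat foldl_cat fw3 fw' sz3 -qE; split => //.
by rewrite subnK.
Qed.

(** * Following and catching cycles *)

Section CycleTrajectories.
Context {S A : finType}.
Variables (N : S -> A -> S) (g : nat) (cls : S -> 'I_g) (s1 : S).

Lemma size_walk_acts (c : walk S A) : size (walk_acts c) = walk_len c.
Proof. exact: size_tuple. Qed.

(** Within a round one more action is read; at the wrap-around the full action word and the empty
    one lead to the same state because the walk is closed. *)
Lemma cycle_stateS (c : walk S A) (t : nat) : is_cycle N cls s1 c ->
  cycle_state N c t.+1 = N (cycle_state N c t) (cycle_action c t).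
Proof.
case/andP => /eqP closed _; rewrite /cycle_state.
set x := walk_start c in closed *.
have lt : (t %% walk_len c < walk_len c)%N by rewrite ltn_pmod.
have -> : cycle_action c t = nth (cycle_action c t) (walk_acts c) (t %% walk_len c).
  by rewrite {1}/cycle_action (tnth_nth (cycle_action c t)) inordK.
rewrite -foldl_rcons -take_nth ?size_walk_acts // modnS.
case: ifP => // dv; rewrite take0 take_oversize ?closed // size_walk_acts.
apply: dvdn_leq => //; move: dv.
by rewrite /dvdn -addn1 -modnDml addn1.
Qed.

(** Every cycle moves through the classes in step with the environment. Hence its position [m] steps
    ahead, with [g] dividing [m], lies in the class of the learner, where a route exists. *)
Lemma cycle_state_class (c : walk S A) (t : nat) :
  cyclic_classes N cls -> is_cycle N cls s1 c ->
  cls (cycle_state N c t) = ((cls s1 + t) %% g)%N :> nat.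
Proof.
move=> cyc ic; elim: t => [|t IH].
  case/andP: ic => _ /eqP clsc.
  by rewrite /cycle_state mod0n take0 /= clsc addn0 modn_small.
by rewrite (cycle_stateS _ ic) (proj2 cyc) IH -addn1 modnDml addn1 addnS.
Qed.

Variables (m : nat) (route : S -> S -> seq A) (C : nat -> walk S A) (T : nat).

(** Time 0 counts as a switch, since reaching the first cycle may also need a catch-up. *)
Definition restart (t : nat) : bool := (t == 0%N) || (C t != C t.-1).

Hypothesis cyc : cyclic_classes N cls.
Hypothesis catch : catching_route N cls m route.
Hypothesis dvd_m : (g %| m)%N.
Hypothesis CP : forall t, (t < T)%N -> is_cycle N cls s1 (C t).

Let x t := (learner N s1 m route C t).1.
Let q t := plan N m route C t (learner N s1 m route C t).

(** Invariant of the run: the pending actions lead to the point of the current cycle at the time of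
    arrival, so with nothing pending the learner is on the cycle. The class is carried along because
    routes only join states of one class. *)
Lemma learner_plan (t : nat) : (t < T)%N ->
  cls (x t) = ((cls s1 + t) %% g)%N :> nat /\
  foldl N (x t) (q t) = cycle_state N (C t) (t + size (q t)).
Proof.
have reroute u : (u < T)%N -> restart u ->
    cls (x u) = ((cls s1 + u) %% g)%N :> nat ->
    foldl N (x u) (q u) = cycle_state N (C u) (u + size (q u)).
  move=> uT ru clsu; rewrite /q /plan.
  have -> : learner N s1 m route C u = (x u, (learner N s1 m route C u).2).
    by rewrite /x; case: (learner _ _ _ _ _ _).
  rewrite -/(restart u) ru; case: eqP => [->|_]; first by rewrite addn0.
  have [|-> ->] // := @catch (x u) (cycle_state N (C u) (u + m)).
  apply: val_inj => /=; rewrite clsu cycle_state_class //; last exact: CP.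
  by case/dvdnP: dvd_m => k ->; rewrite addnA [in RHS]addnC modnMDl.
elim: t => [|t IH] tT.
  have c0 : cls (x 0) = ((cls s1 + 0) %% g)%N :> nat.
    by rewrite addn0 modn_small.
  by split => //; apply: reroute.
have [clst qt] := IH (ltnW tT).
have clsS : cls (x t.+1) = ((cls s1 + t.+1) %% g)%N :> nat.
  by rewrite /x /= (proj2 cyc) clst -addn1 modnDml addn1 addnS.
split => //; case: (boolP (restart t.+1)) => [rt|nrt]; first exact: reroute.
move: nrt; rewrite /restart /= negbK => /eqP CS.
have qS : q t.+1 = behead (q t) by rewrite /q /= CS eqxx.
rewrite CS qS /x /= /next_action -/(x t) -/(q t).
case: (q t) qt => [|a r] /= qt.
  by rewrite addn0 in qt *; rewrite qt addn0 -cycle_stateS //; apply/CP/ltnW.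
by rewrite qt addSnnS.
Qed.

Lemma size_plan (t : nat) : (t < T)%N ->
  (size (q t) <= size (learner N s1 m route C t).2 + m * restart t)%N.
Proof.
move=> tT; rewrite /q /plan.
have -> : learner N s1 m route C t = (x t, (learner N s1 m route C t).2).
  by rewrite /x; case: (learner _ _ _ _ _ _).
rewrite /= -/(restart t); case: (boolP (restart t)) => rt; last by rewrite leq_addr.
case: eqP => // _; rewrite muln1.
have [|-> _] := @catch (x t) (cycle_state N (C t) (t + m)).
  apply: val_inj => /=; rewrite cycle_state_class //; last exact: CP.
  rewrite (proj1 (learner_plan tT)).
  by case/dvdnP: dvd_m => k ->; rewrite addnA [in RHS]addnC modnMDl.
by rewrite leq_addl.
Qed.

(** Amortised count with the number of pending actions as potential: a restart adds at most [m], a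
    catch-up step removes one. *)
Lemma catch_up_steps (n : nat) : (n <= T)%N ->
  (\sum_(t < n) (q t != [::]) + size (learner N s1 m route C n).2 <=
   m * \sum_(t < n) restart t)%N.
Proof.
elim: n => [|n IH] nT; first by rewrite !big_ord0.
rewrite !big_ord_recr /= mulnDr -/(q n).
have := IH (ltnW nT); have := size_plan nT.
by case: (q n) => [|a r] /=; lia.
Qed.

(** With nothing pending the learner pays what the current cycle pays; a catch-up step costs at most
    1. *)
Lemma learner_loss_le {R : realType} (loss : nat -> S -> A -> R) :
  (forall t s a, (t < T)%N -> 0 <= loss t s a <= 1) ->
  learner_loss N s1 loss T m route C <=
  \sum_(t < T) loss t (cycle_state N (C t) t) (cycle_action (C t) t)
  + m%:R * (\sum_(t < T) restart t)%:R.
Proof.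
move=> lossP.
have cu : (\sum_(t < T) (q t != [::]) <= m * \sum_(t < T) restart t)%N.
  by apply: leq_trans (catch_up_steps (leqnn T)); rewrite leq_addr.
apply: (@le_trans _ _ (\sum_(t < T) (loss t (cycle_state N (C t) t)
    (cycle_action (C t) t) + (q t != [::])%:R))).
  apply: ler_sum => t _; rewrite /next_action -/(x t) -/(q t).
  have [_] := learner_plan (ltn_ord t).
  have /andP[l0 _] := lossP t (cycle_state N (C t) t) (cycle_action (C t) t) (ltn_ord t).
  case: (q t) => [|a r] /=; first by rewrite addn0 => ->; rewrite addr0.
  move=> _; have /andP[_ l1] := lossP t (x t) a (ltn_ord t).
  by apply: le_trans l1 _; rewrite lerDr.
by rewrite big_split /= lerD2l -natr_sum -natrM ler_nat.
Qed.

End CycleTrajectories.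

(** * The best cycle against the best policy *)

Lemma foldl_traject (S A : finType) (N : S -> A -> S) (p : S -> A) (u : S) (k : nat) :
  foldl N u (map p (traject (fun s => N s (p s)) u k)) =
  iter k (fun s => N s (p s)) u.
Proof. by elim: k u => //= k IH u; rewrite IH -iterSr. Qed.

(* A policy runs into a cycle within #|S| steps; entering this cycle at a
   multiple of its length makes the candidate walk run in phase with the
   policy. *)
Lemma policy_eventually_cycle (S A : finType) (N : S -> A -> S) (g : nat)
    (cls : S -> 'I_g) (s1 : S) (p : S -> A) :
  cyclic_classes N cls ->
  exists c : walk S A, is_cycle N cls s1 c /\
  forall t, (#|S| <= t)%N ->
    cycle_state N c t = policy_state N s1 p t /\
    cycle_action c t = p (policy_state N s1 p t).
Proof.
move=> cyc; pose f s := N s (p s); pose x t := policy_state N s1 p t.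
have [i [k [ik xik]]] : exists i k, (i + k.+1 <= #|S|)%N /\ x (i + k.+1)%N = x i.
  have /injectivePn[i [j ij xij]] : ~~ injectiveb (fun i : 'I_#|S|.+1 => x i).
    by apply/injectiveP => /leq_card; rewrite card_ord ltnn.
  case: (ltngtP i j) => [lt|lt|/val_inj e]; last by rewrite e eqxx in ij.
    exists i, (j - i).-1; have -> : (i + (j - i).-1.+1 = j)%N by lia.
    by rewrite -ltnS.
  exists j, (i - j).-1; have -> : (j + (i - j).-1.+1 = i)%N by lia.
  by rewrite -ltnS.
have xD a b : x (a + b)%N = iter a f (x b) by rewrite /x /policy_state iterD.
have xk t : (i <= t)%N -> x (t + k.+1)%N = x t.
  move=> it; rewrite -{1}(subnK it) -addnA xD xik -xD subnK //.
have xkm r t : (i <= t)%N -> x (t + r * k.+1)%N = x t.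
  move=> it; elim: r => [|r IH]; first by rewrite addn0.
  by rewrite mulSn addnCA addnC xk ?IH //; apply: leq_trans it _; rewrite leq_addr.
have kS : (k < #|S|)%N by apply: leq_trans ik; rewrite leq_addl.
pose b := x (i * k.+1)%N.
have ib : (i <= i * k.+1)%N by rewrite leq_pmulr.
pose acts := map_tuple p (Tuple (introT eqP (size_traject f b k.+1))).
pose c : walk S A := Tagged (fun k : 'I_#|S| => (S * k.+1.-tuple A)%type)
  (i := Ordinal kS) (b, acts).
have xcls t : cls (x t) = ((cls s1 + t) %% g)%N :> nat.
  elim: t => [|t IH]; first by rewrite addn0 modn_small.
  by rewrite /x /policy_state /= (proj2 cyc) IH -addn1 modnDml addn1 addnS.
(* The class determines the time modulo [g], so states recur only after multiples of [g]. This puts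
   the start [b] into the class of [s1]. *)
have gk : (g %| k.+1)%N.
  have := congr1 (fun s => cls s : nat) xik; rewrite /= !xcls addnA => /eqP.
  by rewrite -{2}[(cls s1 + i)%N]addn0 eqn_modDl mod0n.
have stE t : cycle_state N c t = x (t %% k.+1 + i * k.+1)%N.
  rewrite /cycle_state -[walk_start c]/b -[walk_acts c]/(map p (traject f b k.+1)).
  rewrite -[walk_len c]/k.+1 -map_take take_traject ?foldl_traject; last by rewrite ltnW // ltn_pmod.
  by rewrite xD.
exists c; split.
  apply/andP; split.
    apply/eqP; rewrite -[RHS]/b -[walk_start c]/b -[walk_acts c]/(map p (traject f b k.+1)).
    rewrite foldl_traject -/f /b -xD addnC xk //.
  apply/eqP/val_inj; rewrite -[walk_start c]/b /= xcls.
  by case/dvdnP: gk => r ->; rewrite mulnA addnC modnMDl modn_small.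
move=> t St; have it : (i <= t)%N.
  by apply: leq_trans St; apply: leq_trans ik; rewrite leq_addr.
have e : x (t %% k.+1 + i * k.+1)%N = x t.
  rewrite -(xkm (t %/ k.+1)%N); last by apply: leq_trans ib _; rewrite leq_addl.
  by rewrite addnAC [(t %% _ + _)%N]addnC -divn_eq xkm.
split; first by rewrite stE.
rewrite -[policy_state _ _ _ _]/(x t) -e addnC /cycle_action.
have lt : (t %% k.+1 < k.+1)%N by rewrite ltn_pmod.
have -> : walk_len c = k.+1 by [].
rewrite (tnth_nth (p b)) /= inordK //.
rewrite -[_ :: _]/(map p (traject f b k.+1)) (nth_map b) ?size_traject //.
by rewrite nth_traject // addnC xD.
Qed.

Lemma sum_ltn (T k : nat) : (\sum_(t < T) (t < k) = minn T k)%N.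
Proof. by elim: T => [|T IH]; rewrite ?big_ord0 ?big_ord_recr ?IH /=; lia. Qed.

Section BestLosses.
Context {R : realType} {S A : finType}.
Variables (N : S -> A -> S) (g : nat) (cls : S -> 'I_g) (s1 : S) (T : nat).
Variable loss : nat -> S -> A -> R.
Hypothesis cyc : cyclic_classes N cls.
Hypothesis lossP : forall t s a, (t < T)%N -> 0 <= loss t s a <= 1.

Lemma best_cycle_attained (a0 : A) : exists c : walk S A,
  is_cycle N cls s1 c /\ cycle_loss N loss c T = best_cycle_loss N s1 loss T cls.
Proof.
have [c0 [ic0 _]] := policy_eventually_cycle s1 (fun=> a0) cyc.
case: (arg_minP (fun c => cycle_loss N loss c T) ic0) => c ic cmin.
exists c; split => //; apply/eqP; rewrite eq_le; apply/andP; split.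
  by apply: lb_le_inf => [|_ [c' ic' <-]]; [exists (cycle_loss N loss c T), c|exact: cmin].
by apply: ge_inf; [exists (cycle_loss N loss c T) => _ [c' ic' <-]; exact: cmin|exists c].
Qed.

Lemma best_cycle_loss_ge0 (a0 : A) : 0 <= best_cycle_loss N s1 loss T cls.
Proof.
have [c [_ <-]] := best_cycle_attained a0.
by apply: sumr_ge0 => t _; case/andP: (lossP (cycle_state N c t) (cycle_action c t) (ltn_ord t)).
Qed.

Lemma best_cycle_loss_le (a0 : A) :
  best_cycle_loss N s1 loss T cls <= best_policy_loss N s1 loss T + #|S|%:R.
Proof.
rewrite -lerBlDr; apply: lb_le_inf; first by exists (policy_loss N s1 loss T [ffun=> a0]), [ffun=> a0].
move=> _ [p _ <-]; rewrite lerBlDr.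
have [c [ic cE]] := policy_eventually_cycle s1 p cyc.
have [cb [icb bE]] := best_cycle_attained a0.
apply: (@le_trans _ _ (cycle_loss N loss c T)).
  apply: ge_inf; last by exists c.
  exists 0 => _ [c' _ <-]; apply: sumr_ge0 => t _.
  by case/andP: (lossP (cycle_state N c' t) (cycle_action c' t) (ltn_ord t)).
apply: (@le_trans _ _ (\sum_(t < T) (loss t (policy_state N s1 p t)
    (p (policy_state N s1 p t)) + (t < #|S|)%N%:R))).
  apply: ler_sum => t _; case: ltnP => [lt|/cE[-> ->]]; last by rewrite addr0.
  have /andP[_ l1] := lossP (cycle_state N c t) (cycle_action c t) (ltn_ord t).
  have /andP[l0 _] := lossP (policy_state N s1 p t) (p (policy_state N s1 p t)) (ltn_ord t).
  by apply: le_trans l1 _; rewrite lerDr.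
by rewrite big_split /= lerD2l -natr_sum ler_nat sum_ltn geq_minr.
Qed.

End BestLosses.

(** * Perturbed leaders *)

Section Perturbation.
Context {R : realType} {S A : finType}.
Variables (N : S -> A -> S) (g : nat) (cls : S -> 'I_g) (s1 : S) (T : nat).
Variable loss : nat -> S -> A -> R.

(** Turns the noise of a cycle into a sum over a set of coordinates: one [delta] entry, and one
    [epsilon] entry per step. The step index keeps the latter distinct. *)
Definition uses (c : walk S A) (j : noise_index S A) : bool :=
  match j with
  | inl (s, k) => (s, k) == (walk_start c, tag c)
  | inr (i, sa) =>
      (i < walk_len c)%N && (sa == (cycle_state N c i, cycle_action c i))
  end.

Definition perturbation (z : noise_index S A -> R) (c : walk S A) : R :=
  \sum_(j | uses c j) z j.

Lemma perturbationE (z : noise_index S A -> R) (c : walk S A) :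
  perturbation z c = z (inl (walk_start c, tag c)) +
     \sum_(i < #|S| | (i < walk_len c)%N)
        z (inr (i, (cycle_state N c i, cycle_action c i))).
Proof.
rewrite /perturbation big_sumType /=; congr (_ + _).
  by rewrite (big_pred1 (walk_start c, tag c)) // => -[s k].
under [RHS]eq_bigr => i _.
  rewrite -(big_pred1_eq +%R (cycle_state N c i, cycle_action c i)
    (fun sa => z (inr (i, sa)))).
  over.
by rewrite pair_big_dep /=; apply: eq_big => -[i sa].
Qed.

Lemma perturbed_lossE (z : noise_index S A -> R) (t : nat) (c : walk S A) :
  perturbed_loss N loss z t c = cycle_loss N loss c t - perturbation z c.
Proof. by rewrite /perturbed_loss perturbationE. Qed.

(** Counting the coordinates is evaluating [perturbation] at the noise constantly 1. *)
Lemma card_uses (c : walk S A) : (#|[pred j | uses c j]| <= #|S|.+1)%N.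
Proof.
rewrite -(ler_nat R) -sum1_card natr_sum.
have -> : \sum_(i in [pred j | uses c j]) 1%:R = perturbation (fun=> 1) c by [].
rewrite perturbationE -[#|S|.+1]add1n natrD lerD2l big_mkcond /=.
apply: (@le_trans _ _ (\sum_(i < #|S|) 1)); last by rewrite sumr_const card_ord.
by apply: ler_sum => i _; case: ifP => _; rewrite ?lexx ?ler01.
Qed.

(** The [delta] coordinate determines start and length, the [epsilon] coordinates the actions, so a
    cycle using all coordinates of [c] equals [c]. *)
Lemma uses_neq (c c' : walk S A) : c != c' -> exists j, uses c j && ~~ uses c' j.
Proof.
move=> /eqP ne; apply/existsP; apply: contra_notT ne.
rewrite negb_exists => /forallP sub; have {}sub j : uses c j -> uses c' j.
  by move=> uj; have := sub j; rewrite uj negbK.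
have := sub (inl (walk_start c, tag c)); rewrite /= eqxx => /(_ isT)/eqP[].
move: sub; case: c => k [s w]; case: c' => k' [s' w'].
rewrite /walk_start /= => sub e e'; subst s' k'.
suff -> : w = w' by [].
apply: eq_from_tnth => i.
have iS : (i < #|S|)%N by apply: leq_trans (ltn_ord i) _.
have := sub (inr (Ordinal iS, _)).
move=> /(_ (cycle_state N (existT _ k (s, w)) i, cycle_action (existT _ k (s, w)) i)).
rewrite /= eqxx andbT => /(_ (ltn_ord i))/andP[_ /eqP[_]].
rewrite /cycle_action /= /walk_len /= modn_small ?ltn_ord //.
by rewrite inord_val => ->.
Qed.

Definition update (z : noise_index S A -> R) (j : noise_index S A) (y : R) :=
  fun i => if i == j then y else z i.

Lemma perturbation_update z j x y c :
  perturbation (update z j y) c =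
  perturbation (update z j x) c + (uses c j)%:R * (y - x).
Proof.
rewrite /perturbation; case: (boolP (uses c j)) => uj; last first.
  rewrite mul0r addr0; apply: eq_bigr => i ui; rewrite /update.
  by case: eqP => // e; rewrite -e ui in uj.
have rest v : \sum_(i | uses c i && (i != j)) update z j v i =
    \sum_(i | uses c i && (i != j)) z i.
  by apply: eq_bigr => i /andP[_ /negbTE ij]; rewrite /update ij.
by rewrite (bigD1 j) //= [in RHS](bigD1 j) //= !rest /update eqxx; ring.
Qed.

Hypothesis lossP : forall t s a, (t < T)%N -> 0 <= loss t s a <= 1.

Notation leader := (is_leader N s1 loss cls).

Definition step_loss (c : walk S A) (t : nat) : R :=
  loss t (cycle_state N c t) (cycle_action c t).

Lemma step_loss_ge0 c t : (t < T)%N -> 0 <= step_loss c t.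
Proof. by move=> tT; case/andP: (lossP (cycle_state N c t) (cycle_action c t) tT). Qed.

Lemma step_loss_le1 c t : (t < T)%N -> step_loss c t <= 1.
Proof. by move=> tT; case/andP: (lossP (cycle_state N c t) (cycle_action c t) tT). Qed.

Lemma perturbed_lossS z t c :
  perturbed_loss N loss z t.+1 c = perturbed_loss N loss z t c + step_loss c t.
Proof. by rewrite !perturbed_lossE /cycle_loss big_ord_recr /= addrAC. Qed.

(** The challenger [c'] need not become the next leader. Since it avoids [j], the event bounds [z j]
    from above once the other coordinates are fixed. *)
Definition overtaken (z : noise_index S A -> R) (t : nat) (c : walk S A)
    (j : noise_index S A) : Prop :=
  leader z t c /\ exists c', [/\ is_cycle N cls s1 c', ~~ uses c' j &
    perturbed_loss N loss z t.+1 c' < perturbed_loss N loss z t.+1 c].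

(** Raising a coordinate that [c] uses lowers its perturbed loss at least as much as that of any
    rival. *)
Lemma leader_update z t c j x y : uses c j -> x <= y ->
  leader (update z j x) t c -> leader (update z j y) t c.
Proof.
move=> uj xy [ic lead]; split => // c' ic'; have := lead c' ic'.
rewrite !perturbed_lossE !(perturbation_update z j x y) uj.
by case: (uses c' j) => /=; lra.
Qed.

(** At the value [x] the challenger is not ahead of [c]. Going to [y] gains [c] exactly [y - x], and
    the step sets it back by at most [step_loss c t], the challenger's own loss being
    nonnegative. *)
Lemma overtaken_update z t c j x y : (t < T)%N -> uses c j ->
  leader (update z j x) t c -> overtaken (update z j y) t c j ->
  y < x + step_loss c t.
Proof.
move=> tT uj [ic lead] [_ [c' [ic' uj' lt]]].
have := lead c' ic'; have := step_loss_ge0 c' tT; move: lt.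
rewrite !perturbed_lossS !perturbed_lossE !(perturbation_update z j x y).
by rewrite uj (negbTE uj') /=; lra.
Qed.

Variables (z : noise_index S A -> R) (C : nat -> walk S A).
Hypothesis run : fpl_run N s1 loss T cls z C.

(** The previous cycle is kept while it is still a minimiser, so a switch needs a strictly better
    cycle, not merely a tie; [uses_neq] then separates the two. *)
Lemma switch_overtaken t : (t.+1 < T)%N -> C t.+1 != C t ->
  exists j, uses (C t) j /\ overtaken z t (C t) j.
Proof.
move=> tT /eqP sw; have [lead stay] := run.
have [ic ld] := lead t (ltnW tT).
have : ~ leader z t.+1 (C t) by move=> /(stay t tT).
move=> nl; have [c' [ic' lt]] : exists c', is_cycle N cls s1 c' /\
    perturbed_loss N loss z t.+1 c' < perturbed_loss N loss z t.+1 (C t).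
  apply: contrapT => ne; apply: nl; split => // c' ic'.
  by rewrite leNgt; apply/negP => lt; apply: ne; exists c'.
have /uses_neq[j /andP[uj uj']] : C t != c' by apply: contraTneq lt => <-; rewrite ltxx.
by exists j; split => //; split => //; exists c'.
Qed.

(* Be-the-leader argument: a step of the leader that is not followed by a
   switch is charged to the potential perturbed_loss of the leader. *)
Lemma leader_loss_le (c : walk S A) : (0 < T)%N -> is_cycle N cls s1 c ->
  \sum_(t < T) step_loss (C t) t <=
  cycle_loss N loss c T - perturbation z c + perturbation z (C 0%N)
  + (\sum_(t < T) restart C t)%:R.
Proof.
have [lead _] := run.
have btl n : (n < T)%N ->
    \sum_(t < n) step_loss (C t) t <= perturbed_loss N loss z n (C n)
    + perturbation z (C 0%N) + (\sum_(t < n) (C t.+1 != C t))%:R.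
  elim: n => [|n IH] nT.
    by rewrite !big_ord0 addr0 perturbed_lossE /cycle_loss big_ord0; lra.
  rewrite !big_ord_recr /= natrD; have := IH (ltnW nT).
  have l0 := step_loss_ge0 (C n.+1) (ltnW nT).
  have l1 := step_loss_le1 (C n) (ltnW nT).
  rewrite perturbed_lossS; case: eqP => [->|_] /=; first by lra.
  (* At a switch the potential does not drop, and the loss of the step, at most 1, is paid by the
     counted switch. *)
  have := (lead n (ltnW nT)).2 _ (lead _ nT).1; lra.
(* The run prescribes no leader after the last step. That step is charged 1, which the restart at
   time 0 pays for. *)
case: T lossP lead btl => // T' lossP' lead btl _ ic.
rewrite big_ord_recr /= big_ord_recl natrD /=.
have := btl T' (ltnSn _).
have : step_loss (C T') T' <= 1.
  by case/andP: (lossP' T' (cycle_state N (C T') T') (cycle_action (C T') T') (ltnSn _)).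
have : 0 <= step_loss c T'.
  by case/andP: (lossP' T' (cycle_state N c T') (cycle_action c T') (ltnSn _)).
have := (lead T' (ltnSn _)).2 c ic; rewrite [leRHS]perturbed_lossE.
rewrite /cycle_loss [in X in _ -> _ -> _ -> X]big_ord_recr /=.
rewrite -[loss T' _ _]/(step_loss c T') /restart /=; lra.
Qed.

End Perturbation.

(** * Conditioning on all but one noise coordinate *)

Section CoordinateIndependence.
Context d (Omega : measurableType d) (R : realType) (P : probability Omega R).
Variables (J : finType) (Z : J -> {RV P >-> R}).
Hypothesis indep : independent_RVs Z.
Variable j : J.

(** Cylinder events leaving coordinate [j] free: a pi-system generating the sigma-algebra of the
    other coordinates. *)
Let boxes : set (set Omega) := [set E | exists B : J -> set R,
  [/\ forall i, measurable (B i), B j = setT &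
      E = \bigcap_(i in [set: J]) (Z i @^-1` B i)]].

Let others := g_sigma_algebraType boxes.

Let measurable_preim i (B : set R) : measurable B -> measurable (Z i @^-1` B).
Proof. by move=> mB; rewrite -[X in measurable X]setTI; exact: measurable_funP. Qed.

Let boxesI : setI_closed boxes.
Proof.
move=> _ _ [B [mB Bj ->]] [B' [mB' Bj' ->]].
exists (fun i => B i `&` B' i); split => [i||]; first exact: measurableI.
  by rewrite Bj Bj' setIT.
by rewrite -bigcapI; apply: eq_bigcapr => i _; rewrite preimage_setI.
Qed.

Let boxes_indep (D : set R) (E : set Omega) : measurable D -> boxes E ->
  (P (Z j @^-1` D `&` E) = P (Z j @^-1` D) * P E)%E.
Proof.
move=> mD [B [mB Bj ->]].
have -> : Z j @^-1` D `&` \bigcap_(i in [set: J]) (Z i @^-1` B i) =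
    \bigcap_(i in [set: J]) (Z i @^-1` (if i == j then D else B i)).
  apply/seteqP; split => [w [Dw Bw] i _|w Bw].
    by case: eqP => [->//|_]; apply: Bw.
  split; first by have := Bw j I; rewrite eqxx.
  move=> i _; have := Bw i I; case: eqP => // -> _.
  by rewrite Bj.
rewrite !indep //; last by move=> i; case: eqP.
rewrite (bigD1 j) //= [in RHS](bigD1 j) //= eqxx Bj preimage_setT.
rewrite [P setT]probability_setT mul1e; congr (_ * _)%E.
by apply: eq_bigr => i /negbTE ->.
Qed.

(** Pi-lambda argument: the events independent of [Z j] form a Dynkin system containing [boxes]. *)
Let others_indep (D : set R) (E : set Omega) : measurable D -> <<s boxes >> E ->
  measurable E /\ (P (Z j @^-1` D `&` E) = P (Z j @^-1` D) * P E)%E.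
Proof.
move=> mD; rewrite -setI_closed_g_dynkin_g_sigma_algebra //.
have mZ := measurable_preim j mD.
move: E; apply: smallest_sub => [|E bE]; last first.
  split; last exact: boxes_indep.
  case: bE => B [mB _ ->]; apply: fin_bigcap_measurable => // i _.
  exact: measurable_preim.
split.
- by split => //; rewrite setIT [P setT]probability_setT mule1.
- move=> E [mE PE]; split; first exact: measurableC.
  have -> : (P (Z j @^-1` D `&` ~` E) = P (Z j @^-1` D) - P (Z j @^-1` D `&` E))%E.
    by rewrite -setDE measureD // -ge0_fin_numE ?fin_num_measure.
  rewrite PE probability_setC // muleBr ?mule1 ?fin_num_measure //.
- move=> F tF FP; split; first by apply: bigcup_measurable => k _; case: (FP k).
  have mF k : measurable (F k) by case: (FP k).
  rewrite setI_bigcupr !measure_bigcup //.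
  + rewrite -[P (Z j @^-1` D)]fineK ?fin_num_measure //.
    rewrite -nneseriesZl //.
    apply: eq_eseriesr => k _; rewrite fineK ?fin_num_measure //. 
    by case: (FP k).
  + by move=> k _; exact: measurableI.
  + exact: trivIset_setIl.
Qed.

(** Measurability is tested along measurable families, so that one notion serves families over
    [Omega], over a single coordinate, and over that coordinate paired with the others. *)
Definition measurable_event (X : set (J -> R)) : Prop :=
  forall d' (T : measurableType d') (f : J -> T -> R),
    (forall i, measurable_fun setT (f i)) -> measurable [set t | X (f^~ t)].

(** The identity into the coarser sigma-algebra; its law is the joint law of the coordinates other
    than [j]. *)
Let restricted (w : Omega) : others := w.

Let measurable_restricted : measurable_fun setT restricted.
Proof.
move=> _ E mE; rewrite setTI.
by have [] := others_indep measurableT mE.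
Qed.

HB.instance Definition _ := isMeasurableFun.Build _ _ _ _ restricted measurable_restricted.

Let joint (w : Omega) : others * R := (restricted w, Z j w).

Let measurable_joint : measurable_fun setT joint.
Proof. by apply: measurable_fun_pair => //; exact: measurable_funP. Qed.

HB.instance Definition _ := isMeasurableFun.Build _ _ _ _ joint measurable_joint.

(* Fubini for the product of the law of Z j with the law of all other
   coordinates. *)
Lemma coordinate_le (X Y : set (J -> R)) (a : R) : 0 <= a ->
  measurable_event X -> measurable_event Y ->
  (forall z : J -> R,
    (distribution P (Z j) [set y | X (fun i => if i == j then y else z i)] <=
     a%:E * distribution P (Z j) [set y | Y (fun i => if i == j then y else z i)])%E) ->
  (P [set w | X (fun i => Z i w)] <= a%:E * P [set w | Y (fun i => Z i w)])%E.
Proof.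
move=> a0 mX mY XY.
pose ev (X : set (J -> R)) : set (others * R) :=
  [set p | X (fun i => if i == j then p.2 else Z i p.1)].
have mev V : measurable_event V -> measurable (ev V).
  move=> mV; refine (mV _ (others * R)%type (fun i p => if i == j then p.2 else Z i p.1) _) => i.
  case: (boolP (i == j)) => ij; first exact: measurable_snd.
  apply: (measurableT_comp (f := fun w : others => Z i w)); last exact: measurable_fst.
  move=> _ B mB; rewrite setTI; apply: sub_sigma_algebra.
  exists (fun k => if k == i then B else setT); split => [k||].
  - by case: ifP.
  - by rewrite eq_sym (negbTE ij).
  - apply/seteqP; split => [w Bw k _|w /(_ i I)]; last by rewrite eqxx.
    by case: eqP => [->|].
(* By independence the law of [joint] is a product measure. *)
have evE V : measurable_event V ->
    P [set w | V (fun i => Z i w)] =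
    (distribution P restricted \x distribution P (Z j))%E (ev V).
  move=> mV; rewrite (@product_measure_unique _ _ _ _ _ _ _ (distribution P joint)) //.
  - rewrite /distribution /pushforward; congr (P _); apply/seteqP; split => w /=;
    congr V; apply/funext => i; by case: eqP => // ->.
  - move=> E D mE mD; rewrite muleC.
    by have [_ <-] := others_indep mD mE; rewrite setIC.
  - exact: mev.
rewrite !evE // /product_measure1 -ge0_integralZl //.
- apply: ge0_le_integral => //.
  + by apply: measurable_fun_xsection; exact: mev.
  + by apply: measurable_funeM; apply: measurable_fun_xsection; exact: mev.
  + move=> w _ /=; have := XY (fun i => Z i w).
    by rewrite /xsection /ev /=; congr (_ <= _ * _)%E; congr (distribution _ _ _);
      apply/seteqP; split => y /=; rewrite inE.
- by apply: measurable_fun_xsection; exact: mev.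
Qed.

End CoordinateIndependence.

(** * The exponential distribution *)

Section ExponentialVariable.
Context d (Omega : measurableType d) (R : realType) (P : probability Omega R).
Variables (X : {RV P >-> R}) (rate : R).
Hypotheses (rate_gt0 : 0 < rate) (expX : exponential_RV rate X).

Let dist_le_setU (A B : set R) : measurable A -> measurable B ->
  (distribution P X (A `|` B) <= distribution P X A + distribution P X B)%E.
Proof. exact: measureU2. Qed.

Let dist_setU (A B : set R) : measurable A -> measurable B -> A `&` B = set0 ->
  (distribution P X (A `|` B) = distribution P X A + distribution P X B)%E.
Proof. exact: measureU. Qed.

Let dist_setD (A B : set R) : measurable A -> measurable B -> B `<=` A ->
  (distribution P X (A `\` B) = distribution P X A - distribution P X B)%E.
Proof.
move=> mA mB BA; rewrite -[in RHS](setIidr BA); apply: measureD => //.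
by rewrite -ge0_fin_numE ?fin_num_measure.
Qed.

Lemma exponential_negative : distribution P X `]-oo, 0[ = 0%E.
Proof.
rewrite expX //; apply: integral0_eq => x /=.
by rewrite in_itv /= => x0; rewrite lt0_exponential_pdf.
Qed.

Lemma exponential_atom (v : R) : distribution P X [set v] = 0%E.
Proof. by rewrite expX //; exact: integral_set1. Qed.

Lemma exponential_tail (v : R) :
  distribution P X `]v, +oo[ = (expR (- rate * Num.max v 0))%:E.
Proof.
have cdfE : distribution P X `]-oo, v] = (1 - expR (- rate * Num.max v 0))%:E.
  have le0 : v <= 0 -> distribution P X `]-oo, v] = 0%E.
    move=> v0; apply/eqP; rewrite eq_le measure_ge0 andbT.
    apply: (@le_trans _ _ (distribution P X (`]-oo, 0[ `|` [set 0]))).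
      apply: le_measure; rewrite ?inE //; first by apply: measurableU.
      move=> x /=; rewrite !in_itv /= => xv.
      by have := le_trans xv v0; rewrite le_eqVlt => /orP[/eqP->|]; [right|left].
    apply: (le_trans (dist_le_setU _ _)) => //.
    by rewrite exponential_negative exponential_atom adde0.
  case: (ltP 0 v) => v0; last by rewrite le0 ?mulr0 ?expR0 ?subrr.
  have -> : [set` `]-oo, v]] = `]-oo, 0[ `|` `[0, v] :> set R.
    by rewrite -itv_bndbnd_setU // bnd_simp ltW.
  rewrite dist_setU //; last first.
    apply/seteqP; split => x //= -[]; rewrite !in_itv /= => x0 /andP[].
    by rewrite leNgt x0.
  by rewrite exponential_negative add0e expX // exponential_prob_itv0c.
have -> : [set` `]v, +oo[] = setT `\` `]-oo, v] :> set R by rewrite setTD setCitvl.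
rewrite dist_setD // cdfE [distribution P X setT]probability_setT -EFinB.
by congr (_%:E); ring.
Qed.

(* Memorylessness. In the application L and D are the values of one coordinate
   of the noise for which a cycle leads, resp. leads and is then overtaken. *)
Lemma exponential_window (L D : set R) (p : R) : 0 <= p ->
  measurable L -> measurable D -> D `<=` L ->
  (forall x y, x <= y -> L x -> L y) ->
  (forall x y, L x -> D y -> y < x + p) ->
  (distribution P X D <= (rate * p)%:E * distribution P X L)%E.
Proof.
move=> p0 mL mD DL Lup LD.
have [[y0 Dy0]|D0] := pselect (D !=set0); last first.
  have -> : D = set0 by apply/seteqP; split => // x Dx; case: D0; exists x.
  by rewrite measure0 mule_ge0 // lee_fin mulr_ge0 // ltW.
have L0 : L !=set0 by exists y0; exact: DL.
have lbL : has_lbound L by exists (y0 - p) => x /LD/(_ Dy0); lra.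
(* [L] is closed upwards, so up to the null point [v] it is the half-line above [v], while [D] lies
   between [v] and [v + p]. *)
set v := inf L.
have tailL : `]v, +oo[ `<=` L.
  move=> y /=; rewrite in_itv /= andbT => /(inf_lt L0)[x Lx xy].
  exact: Lup (ltW xy) Lx.
have Dwin : D `<=` [set v] `|` (`]v, +oo[ `\` `]v + p, +oo[).
  move=> y Dy /=; have vy : v <= y by apply: ge_inf => //; exact: DL.
  have yvp : y <= v + p.
    by rewrite -lerBlDr; apply: lb_le_inf => // x /LD/(_ Dy); lra.
  move: vy; rewrite le_eqVlt => /orP[/eqP <-|vy]; first by left.
  by right; rewrite /= !in_itv /= !andbT vy; split => //; apply/negP; rewrite -leNgt.
have mU : measurable ([set v] `|` (`]v, +oo[ `\` `]v + p, +oo[)).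
  by apply: measurableU => //; exact: measurableD.
apply: (@le_trans _ _ (distribution P X ([set v] `|` (`]v, +oo[ `\` `]v + p, +oo[)))).
  by apply: le_measure; rewrite ?inE.
apply: (le_trans (dist_le_setU _ _)) => //; first exact: measurableD.
apply: (@le_trans _ _ ((rate * p)%:E * distribution P X `]v, +oo[)%E); last first.
  apply: lee_wpmul2l; first by rewrite lee_fin mulr_ge0 // ltW.
  by apply: le_measure; rewrite ?inE.
rewrite exponential_atom add0e dist_setD //; last first.
  by move=> y /=; rewrite !in_itv /= !andbT; apply: le_lt_trans; rewrite lerDl.
rewrite !exponential_tail -EFinB -EFinM lee_fin.
(* A negative threshold only shortens the window, whence [le_max]; the rest is
   [1 - expR (- x) <= x]. *)
set a := Num.max v 0.
have le_max : Num.max (v + p) 0 <= a + p.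
  by rewrite ge_max /a; case: (leP v 0) => ?; apply/andP; split; lra.
have : expR (- rate * a) * expR (- rate * p) <= expR (- rate * Num.max (v + p) 0).
  rewrite -expRD ler_expR; have := rate_gt0; nra.
have := expR_ge1Dx (- rate * p); have := expR_gt0 (- rate * a); nra.
Qed.

(** Tail integral: the tail at [a + r] is [expR (- rate * a) / rate] times the density at [r], and
    the density integrates to 1. *)
Lemma exponential_excess (a : R) : 0 <= a ->
  (\int[P]_w (Num.max (X w - a) 0)%:E = (expR (- rate * a) / rate)%:E)%E.
Proof.
move=> a0; pose Y w := Num.max (X w - a) 0.
have mY : measurable_fun setT Y.
  by apply: measurable_maxr => //; exact: measurable_funB.
pose Y' : {mfun Omega >-> R} := HB.pack Y (isMeasurableFun.Build _ _ _ _ Y mY).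
rewrite -(expectation_def (P := P) Y') ge0_expectation_ccdf => [|w]; last first.
  by rewrite /= /Y le_max lexx orbT.
have pdf1 : (\int[lebesgue_measure]_(r in `[0%R, +oo[) (exponential_pdf rate r)%:E = 1)%E.
  rewrite -[LHS]expX // -setCitvl -setTD dist_setD //.
  by rewrite exponential_negative sube0 [distribution P X setT]probability_setT.
transitivity (\int[lebesgue_measure]_(r in `[0%R, +oo[)
    ((expR (- rate * a) / rate)%:E * (exponential_pdf rate r)%:E))%E; last first.
  rewrite ge0_integralZl //= ?pdf1 ?mule1 //.
  - apply/measurable_EFinP; apply: measurable_funTS.
    exact: measurable_exponential_pdf.
  - by move=> r /=; rewrite lee_fin exponential_pdf_ge0 // ltW.
  - by rewrite lee_fin divr_ge0 ?expR_ge0 // ltW.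
apply: eq_integral => r; rewrite inE /= in_itv /= andbT => r0.
rewrite exponential_pdfE // /ccdf.
have -> : distribution P Y' `]r, +oo[ = distribution P X `](a + r), +oo[.
  rewrite /distribution /pushforward; congr (P _); apply/seteqP; split => w /=;
    by rewrite !in_itv /= !andbT /Y lt_max [r < 0]ltNge r0 orbF ltrBrDl.
rewrite exponential_tail max_l; last by rewrite addr_ge0.
rewrite mulrDr expRD -EFinM; congr (_%:E).
by field; rewrite gt_eqF.
Qed.

End ExponentialVariable.

(** * Switching probability *)

Lemma measure_le_cover d (Omega : measurableType d) (R : realType)
    (mu : {measure set Omega -> \bar R}) (J : finType) (Q : pred J)
    (A : set Omega) (B : J -> set Omega) :
  measurable A -> (forall j, measurable (B j)) ->
  (forall w, A w -> exists j, Q j /\ B j w) ->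
  (mu A <= \sum_(j | Q j) mu (B j))%E.
Proof.
move=> mA mB cover.
have [mU leU] : measurable (\big[setU/set0]_(j | Q j) B j) /\
    (mu (\big[setU/set0]_(j | Q j) B j) <= \sum_(j | Q j) mu (B j))%E.
  apply: (big_ind2 (fun (U : set Omega) (x : \bar R) => measurable U /\ (mu U <= x)%E)).
  - by rewrite measure0.
  - move=> U x V y [mU leU] [mV leV]; split; first exact: measurableU.
    by apply: (le_trans (measureU2 _ mU mV)); apply: leeD.
  - by move=> j _.
apply: le_trans leU; apply: le_measure; rewrite ?inE // => w /cover[j [Qj Bj]].
by rewrite (bigD1 j) //=; left.
Qed.

(** * Measurability of leading, being overtaken, and ties *)

Section Events.
Context {R : realType} {S A : finType}.
Variables (N : S -> A -> S) (g : nat) (cls : S -> 'I_g) (s1 : S).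
Variable loss : nat -> S -> A -> R.

Lemma measurable_perturbed_loss d' (T' : measurableType d')
    (f : noise_index S A -> T' -> R) (t : nat) (c : walk S A) :
  (forall i, measurable_fun setT (f i)) ->
  measurable_fun setT (fun x => perturbed_loss N loss (f^~ x) t c).
Proof.
move=> mf; under eq_fun do rewrite perturbed_lossE /perturbation -big_filter.
by apply: measurable_funB => //; apply: measurable_sum.
Qed.

Lemma measurable_le d' (T' : measurableType d') (f h : T' -> R) :
  measurable_fun setT f -> measurable_fun setT h -> measurable [set x | f x <= h x].
Proof.
move=> mf mh; have := measurable_fun_ler mf mh measurableT.
by move=> /(_ [set true] I); rewrite setTI.
Qed.

Lemma measurable_lt d' (T' : measurableType d') (f h : T' -> R) :
  measurable_fun setT f -> measurable_fun setT h -> measurable [set x | f x < h x].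
Proof.
move=> mf mh; have := measurable_fun_ltr mf mh measurableT.
by move=> /(_ [set true] I); rewrite setTI.
Qed.

Lemma measurable_leader (t : nat) (c : walk S A) :
  measurable_event (fun z => is_leader N s1 loss cls z t c).
Proof.
move=> d' T' f mf; case: (boolP (is_cycle N cls s1 c)) => ic; last first.
  by rewrite (_ : [set _ | _] = set0) //; apply/seteqP; split => // x [/(negP ic)].
rewrite (_ : [set _ | _] = \bigcap_(c' in [set c' | is_cycle N cls s1 c'])
  [set x | perturbed_loss N loss (f^~ x) t c <= perturbed_loss N loss (f^~ x) t c']).
  apply: fin_bigcap_measurable => [|c' _]; first exact: finite_finset.
  by apply: measurable_le; apply: measurable_perturbed_loss.
by apply/seteqP; split => x; [case => _ le c' ic'; exact: le|move=> le; split].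
Qed.

Lemma measurable_overtaken (t : nat) (c : walk S A) (j : noise_index S A) :
  measurable_event (fun z => overtaken N cls s1 loss z t c j).
Proof.
move=> d' T' f mf.
rewrite (_ : [set _ | _] = [set x | is_leader N s1 loss cls (f^~ x) t c] `&`
  \bigcup_(c' in [set c' | is_cycle N cls s1 c' && ~~ uses N c' j])
  [set x | perturbed_loss N loss (f^~ x) t.+1 c' < perturbed_loss N loss (f^~ x) t.+1 c]).
  apply: measurableI; first exact: measurable_leader.
  apply: fin_bigcup_measurable => [|c' _]; first exact: finite_finset.
  by apply: measurable_lt; apply: measurable_perturbed_loss.
apply/seteqP; split => x [lead].
  by case=> c' [ic' uj lt]; split => //; exists c' => //; rewrite /= ic' uj.
by case=> c' /andP[ic' uj] lt; split => //; exists c'.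
Qed.

Lemma measurable_tie (t : nat) (c c' : walk S A) :
  measurable_event (fun z => perturbed_loss N loss z t c = perturbed_loss N loss z t c').
Proof.
move=> d' T' f mf.
rewrite (_ : [set _ | _] =
  [set x | perturbed_loss N loss (f^~ x) t c <= perturbed_loss N loss (f^~ x) t c'] `&`
  [set x | perturbed_loss N loss (f^~ x) t c' <= perturbed_loss N loss (f^~ x) t c]).
  by apply: measurableI; apply: measurable_le; apply: measurable_perturbed_loss.
apply/seteqP; split => x /=; first by move=> ->.
by move=> [le1 le2]; apply/eqP; rewrite eq_le le1 le2.
Qed.

End Events.

Section SwitchProbability.
Context {R : realType} {S A : finType}.
Variables (N : S -> A -> S) (g : nat) (cls : S -> 'I_g) (s1 : S) (T : nat).
Variable loss : nat -> S -> A -> R.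
Context (d : measure_display) (Omega : measurableType d) (P : probability Omega R).
Variables (Z : noise_index S A -> {RV P >-> R}) (C : nat -> Omega -> walk S A).
Variable rate : R.
Hypothesis lossP : forall t s a, (t < T)%N -> 0 <= loss t s a <= 1.
Hypothesis indep : independent_RVs Z.
Hypothesis rate_gt0 : 0 < rate.
Hypothesis expZ : forall i, exponential_RV rate (Z i).
Hypothesis mC : forall t c, (t < T)%N -> measurable [set w | C t w = c].
Hypothesis run : forall w, fpl_run N s1 loss T cls (fun i => Z i w) (fun t => C t w).

Let section_measurable (V : set (noise_index S A -> R)) z j :
  measurable_event V -> measurable [set y | V (update z j y)].
Proof.
move=> mV; refine (mV _ R (fun i y => if i == j then y else z i) _) => i.
by case: eqP.
Qed.

Let event_measurable (V : set (noise_index S A -> R)) :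
  measurable_event V -> measurable [set w | V (fun i => Z i w)].
Proof. by move=> mV; refine (mV _ Omega (fun i w => Z i w) _) => i. Qed.

Lemma overtaken_prob t c j : (t < T)%N -> uses N c j ->
  (P [set w | overtaken N cls s1 loss (fun i => Z i w) t c j] <=
   (rate * step_loss N loss c t)%:E *
   P [set w | is_leader N s1 loss cls (fun i => Z i w) t c])%E.
Proof.
move=> tT uj; have p0 := step_loss_ge0 N lossP c tT.
apply: (coordinate_le indep (j := j)
  (X := fun z => overtaken N cls s1 loss z t c j)
  (Y := fun z => is_leader N s1 loss cls z t c)).
- by rewrite mulr_ge0 // ltW.
- exact: measurable_overtaken.
- exact: measurable_leader.
move=> z; apply: exponential_window => //.
- by apply: (section_measurable (V := fun z => is_leader N s1 loss cls z t c) z j); exact: measurable_leader.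
- by apply: (section_measurable (V := fun z => overtaken N cls s1 loss z t c j) z j); exact: measurable_overtaken.
- by move=> y [].
- by move=> x y xy; apply: leader_update.
- by move=> x y; apply: (overtaken_update lossP).
Qed.

(** With the other coordinates fixed, a tie pins a coordinate used by [c] alone to one value, and
    single values are null. *)
Lemma tie_prob t c c' : c != c' ->
  (P [set w | perturbed_loss N loss (fun i => Z i w) t c =
              perturbed_loss N loss (fun i => Z i w) t c'] = 0)%E.
Proof.
move=> /(uses_neq N)[j /andP[uj uj']]; apply/eqP; rewrite eq_le measure_ge0 andbT.
(* Nullity is [coordinate_le] with factor 0 against the sure event. *)
rewrite -[X in (_ <= X)%E](mul0e (P [set w | True])).
apply: (coordinate_le indep (j := j) (Y := setT)
  (X := fun z => perturbed_loss N loss z t c = perturbed_loss N loss z t c')) => //.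
- exact: measurable_tie.
- by move=> d' T' f _; exact: measurableT.
move=> z; rewrite mul0e -(exponential_atom (expZ j)
  (perturbed_loss N loss (update z j 0) t c - perturbed_loss N loss (update z j 0) t c')).
apply: le_measure; rewrite ?inE //.
  apply: (section_measurable
    (V := fun z => perturbed_loss N loss z t c = perturbed_loss N loss z t c') z j).
  exact: measurable_tie.
move=> y /=; rewrite -/(update z j y) !perturbed_lossE.
by rewrite !(perturbation_update N z j 0 y) uj (negbTE uj') /=; lra.
Qed.

(** Several cycles may lead while one is chosen, but a leader that is not chosen ties with the
    chosen one. In [B], [None] stands for being chosen and [Some c'] for a tie with [c']. *)
Lemma leader_prob t c : (t < T)%N ->
  (P [set w | is_leader N s1 loss cls (fun i => Z i w) t c] <=
   P [set w | C t w = c])%E.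
Proof.
move=> tT.
have lead w : is_leader N s1 loss cls (fun i => Z i w) t (C t w).
  by have [ld _] := run w; exact: ld.
pose B (o : option (walk S A)) : set Omega := match o with
  | None => [set w | C t w = c]
  | Some c' => [set w | perturbed_loss N loss (fun i => Z i w) t c =
              perturbed_loss N loss (fun i => Z i w) t c'] end.
apply: (@le_trans _ _ (\sum_(o | (o != Some c)) P (B o))%E).
  apply: measure_le_cover.
  - by apply: (event_measurable (V := fun z => is_leader N s1 loss cls z t c)); exact: measurable_leader.
  - case=> [c'|] /=; last exact: mC.
    apply: (event_measurable
      (V := fun z => perturbed_loss N loss z t c = perturbed_loss N loss z t c')).
    exact: measurable_tie.
  move=> w [ic le]; have [e|ne] := eqVneq (C t w) c; first by exists None.
  exists (Some (C t w)); split => //; apply/eqP.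
  by rewrite eq_le le ?(proj1 (lead w)) // (proj2 (lead w)).
rewrite (bigD1 None) //= big1 ?adde0 // => -[c'|] //= /andP[ne _].
by apply: tie_prob; apply: contraNneq ne => ->.
Qed.

(** Union bound over the cycle and the coordinates it uses. Replacing leading by being chosen,
    through [leader_prob], makes the sum over cycles the expected loss of the leader. *)
Lemma switch_prob t : (t.+1 < T)%N ->
  (P [set w | C t.+1 w != C t w] <=
   (#|S|.+1%:R * rate *
    \sum_c step_loss N loss c t * fine (P [set w | C t w = c]))%:E)%E.
Proof.
move=> tT; have tT' := ltnW tT.
pose q c := fine (P [set w | C t w = c]).
have mCt c : measurable [set w | C t w = c] by exact: mC.
have q0 c : 0 <= q c by rewrite fine_ge0.
have p0 c : 0 <= step_loss N loss c t by exact: (step_loss_ge0 N lossP).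
apply: (@le_trans _ _ (\sum_(cj : walk S A * noise_index S A | uses N cj.1 cj.2)
    P [set w | overtaken N cls s1 loss (fun i => Z i w) t cj.1 cj.2])%E).
  apply: measure_le_cover.
  - rewrite (_ : [set _ | _] = ~` \bigcup_(c in setT)
      ([set w | C t.+1 w = c] `&` [set w | C t w = c])).
      apply: measurableC; apply: fin_bigcup_measurable => [|c _]; first exact: finite_finset.
      by apply: measurableI => //; exact: mC.
    apply/seteqP; split => w /=; first by move=> /eqP ne [c _ [<-]] /esym/ne.
    by move=> ne; apply/eqP => e; apply: ne; exists (C t w).
  - move=> [c j]; apply: (event_measurable (V := fun z => overtaken N cls s1 loss z t c j)).
    exact: measurable_overtaken.
  move=> w sw; have [j [uj ov]] := switch_overtaken (run w) tT sw.
  by exists (C t w, j).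
apply: (@le_trans _ _ (\sum_(cj : walk S A * noise_index S A | uses N cj.1 cj.2)
    (rate * step_loss N loss cj.1 t * q cj.1)%:E)%E).
  apply: lee_sum => -[c j] /= uj; apply: le_trans (overtaken_prob tT' uj) _.
  rewrite [X in (_ <= X)%E]EFinM /q fineK ?fin_num_measure //; apply: lee_wpmul2l; last exact: leader_prob.
  by rewrite lee_fin mulr_ge0 // ltW.
rewrite sumEFin lee_fin mulr_sumr.
rewrite -(pair_big_dep xpredT (fun c j => uses N c j)
  (fun c _ => rate * step_loss N loss c t * q c)) /=.
apply: ler_sum => c _; rewrite sumr_const -[leLHS]mulr_natr.
have -> : #|S|.+1%:R * rate * (step_loss N loss c t * q c) =
    rate * step_loss N loss c t * q c * #|S|.+1%:R by ring.
apply: ler_wpM2l; first by rewrite !mulr_ge0 // ltW.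
by rewrite ler_nat (card_uses (R := R)).
Qed.

End SwitchProbability.

(** * Expected losses *)

(** A nonnegative integral is a supremum over simple functions below the integrand, hence monotone
    for arbitrary functions; applied to the loss of the learner. *)
Lemma ge0_integral_mono d (Omega : measurableType d) (R : realType)
    (mu : {measure set Omega -> \bar R}) (f h : Omega -> \bar R) :
  (forall w, 0 <= f w)%E -> (forall w, f w <= h w)%E ->
  (\int[mu]_w f w <= \int[mu]_w h w)%E.
Proof.
move=> f0 fh; have h0 w : (0 <= h w)%E by exact: le_trans (f0 w) (fh w).
rewrite !ge0_integralTE //; apply: ge_ereal_sup => _ [k kf <-].
by apply: ereal_sup_ubound; exists k => // w; exact: le_trans (kf w) (fh w).
Qed.

Section Expectations.
Context {R : realType} {S A : finType}.
Variables (N : S -> A -> S) (g : nat) (cls : S -> 'I_g) (s1 : S) (T : nat).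
Variable loss : nat -> S -> A -> R.
Context (d : measure_display) (Omega : measurableType d) (P : probability Omega R).
Variables (Z : noise_index S A -> {RV P >-> R}) (C : nat -> Omega -> walk S A).
Variable rate : R.
Hypothesis lossP : forall t s a, (t < T)%N -> 0 <= loss t s a <= 1.
Hypothesis indep : independent_RVs Z.
Hypothesis rate_gt0 : 0 < rate.
Hypothesis expZ : forall i, exponential_RV rate (Z i).
Hypothesis mC : forall t c, (t < T)%N -> measurable [set w | C t w = c].
Hypothesis run : forall w, fpl_run N s1 loss T cls (fun i => Z i w) (fun t => C t w).

Definition mean_step_loss (t : nat) : R :=
  \sum_c step_loss N loss c t * fine (P [set w | C t w = c]).

Let step_lossE t w : step_loss N loss (C t w) t =
  \sum_c step_loss N loss c t * \1_[set w | C t w = c] w.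
Proof.
rewrite (bigD1 (C t w)) //= big1 ?addr0.
  by rewrite indicE mem_set ?mulr1.
move=> c /eqP ne; rewrite indicE memNset ?mulr0 // => /esym; exact: ne.
Qed.

Lemma measurable_step_loss t : (t < T)%N ->
  measurable_fun setT (fun w => step_loss N loss (C t w) t).
Proof.
move=> tT; under eq_fun do rewrite step_lossE.
apply: measurable_sum => c; apply: measurable_funM => //.
by apply: measurable_indic; exact: mC.
Qed.

Lemma integral_step_loss t : (t < T)%N ->
  (\int[P]_w (step_loss N loss (C t w) t)%:E = (mean_step_loss t)%:E)%E.
Proof.
move=> tT; under eq_integral do rewrite step_lossE -sumEFin.
have mI c : measurable_fun setT (\1_[set w | C t w = c] : Omega -> R).
  by apply: measurable_indic; exact: mC.
rewrite ge0_integral_sum //; last 2 first.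
- by move=> c; apply/measurable_EFinP; apply: measurable_funM.
- by move=> c w _; rewrite lee_fin mulr_ge0 // (step_loss_ge0 N lossP).
rewrite -sumEFin; apply: eq_bigr => c _.
under eq_integral do rewrite EFinM.
rewrite ge0_integralZl_EFin //; last 2 first.
- exact/measurable_EFinP.
- exact: (step_loss_ge0 N lossP).
rewrite integral_indic //; last exact: mC.
by rewrite setIT EFinM fineK // fin_num_measure //; exact: mC.
Qed.

Lemma integral_leader_loss :
  (\int[P]_w (\sum_(t < T) step_loss N loss (C t w) t)%:E =
   (\sum_(t < T) mean_step_loss t)%:E)%E.
Proof.
under eq_integral do rewrite -sumEFin.
rewrite ge0_integral_sum //; last 2 first.
- by move=> t; apply/measurable_EFinP; exact: measurable_step_loss.
- by move=> t w _; rewrite lee_fin (step_loss_ge0 N lossP).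
by rewrite -sumEFin; apply: eq_bigr => t _; exact: integral_step_loss.
Qed.

Let switch t : set Omega := [set w | C t.+1 w != C t w].

Let measurable_switch t : (t.+1 < T)%N -> measurable (switch t).
Proof.
move=> tT; rewrite (_ : switch t = ~` \bigcup_(c in setT)
  ([set w | C t.+1 w = c] `&` [set w | C t w = c])).
  apply: measurableC; apply: fin_bigcup_measurable => [|c _]; first exact: finite_finset.
  by apply: measurableI; apply: mC => //; exact: ltnW.
apply/seteqP; split => w /=; first by move=> /eqP ne [c _ [<-]] /esym/ne.
by move=> ne; apply/eqP => e; apply: ne; exists (C t w).
Qed.

Let restartsE T' w : (\sum_(t < T'.+1) restart (fun t => C t w) t)%:R =
  1 + \sum_(t < T') \1_(switch t) w :> R.
Proof.
rewrite big_ord_recl natrD natr_sum; congr (_ + _); apply: eq_bigr => t _.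
by rewrite indicE; congr (nat_of_bool _)%:R; apply/idP/idP; rewrite inE.
Qed.

Definition mean_restarts : R :=
  fine (\int[P]_w (\sum_(t < T) restart (fun t => C t w) t)%:R%:E)%E.

Lemma measurable_restarts : (0 < T)%N ->
  measurable_fun setT (fun w => (\sum_(t < T) restart (fun t => C t w) t)%:R : R).
Proof.
move: measurable_switch; case: T => // T' mS _.
under eq_fun do rewrite restartsE.
apply: measurable_funD => //; apply: measurable_sum => t.
apply: measurable_indic.
by apply: mS; rewrite ltnS.
Qed.

Lemma integral_restarts_le : (0 < T)%N ->
  (\int[P]_w (\sum_(t < T) restart (fun t => C t w) t)%:R%:E <=
   (1 + #|S|.+1%:R * rate * \sum_(t < T) mean_step_loss t)%:E)%E.
Proof.
move=> T0.
have mS := measurable_switch.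
have sP := switch_prob lossP indep rate_gt0 expZ mC run.
have ms0 t : (t < T)%N -> 0 <= mean_step_loss t.
  move=> tT; apply: sumr_ge0 => c _; rewrite mulr_ge0 ?fine_ge0 //.
  exact: (step_loss_ge0 N lossP).
case: T T0 mS sP ms0 => // T' _ mS sP ms0.
under eq_integral do rewrite restartsE EFinD -sumEFin.
have mI (t : 'I_T') : measurable_fun setT (fun w => (\1_(switch t) w)%:E : \bar R).
  apply/measurable_EFinP; apply: measurable_indic.
  by apply: mS; rewrite ltnS.
rewrite ge0_integralD //; last 2 first.
- by move=> w _; apply: sume_ge0 => t _; rewrite lee_fin.
- exact: emeasurable_sum.
have -> : (\int[P]_w 1%:E = 1)%E by rewrite integral_cst // mul1e; exact: probability_setT.
rewrite EFinD; apply: leeD => //.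
rewrite ge0_integral_sum //.
(* Only the first [T'] steps can be followed by a switch; the last mean loss is nonnegative
   slack. *)
rewrite big_ord_recr /= mulrDr mulr_sumr EFinD -sumEFin -[leLHS]adde0.
apply: leeD; last by rewrite lee_fin !mulr_ge0 ?ms0 // ltW.
apply: lee_sum => t _; rewrite integral_indic //; last by apply: mS; rewrite ltnS.
by rewrite setIT; apply: sP; rewrite ltnS.
Qed.

Lemma mean_restartsE : (0 < T)%N ->
  (\int[P]_w (\sum_(t < T) restart (fun t => C t w) t)%:R%:E = mean_restarts%:E)%E.
Proof.
move=> T0; rewrite /mean_restarts fineK // ge0_fin_numE.
  by apply: le_lt_trans (integral_restarts_le T0) _; rewrite ltry.
by apply: integral_ge0 => w _; rewrite lee_fin.
Qed.

Lemma mean_restarts_ge0 : 0 <= mean_restarts.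
Proof. by apply: fine_ge0; apply: integral_ge0 => w _; rewrite lee_fin. Qed.

Lemma mean_restarts_le : (0 < T)%N ->
  mean_restarts <= 1 + #|S|.+1%:R * rate * \sum_(t < T) mean_step_loss t.
Proof. by move=> T0; rewrite -lee_fin -mean_restartsE // integral_restarts_le. Qed.

Let excess (a : R) (i : noise_index S A) (w : Omega) : R := Num.max (Z i w - a) 0.

Let measurable_excess a i : measurable_fun setT (excess a i).
Proof. by apply: measurable_maxr => //; exact: measurable_funB. Qed.

(* The leader is random, so the excesses of all coordinates are summed. *)
Let perturbation_le a w c : 0 <= a ->
  perturbation N (fun i => Z i w) c <= #|S|.+1%:R * a + \sum_i excess a i w.
Proof.
move=> a0; apply: (@le_trans _ _ (\sum_(i | uses N c i) (a + excess a i w))).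
  by apply: ler_sum => i _; rewrite -lerBlDl /excess le_max lexx.
rewrite big_split /=; apply: lerD.
  rewrite sumr_const -[leLHS]mulr_natl; apply: ler_wpM2r => //.
  by rewrite ler_nat (card_uses (R := R)).
rewrite [leRHS](bigID (uses N c)) /= lerDl; apply: sumr_ge0 => i _.
by rewrite /excess le_max lexx orbT.
Qed.

(** Expectation of [leader_loss_le]. The noise of [c] is almost surely nonnegative and is dropped;
    that of the first leader is cut at the threshold [a], its excess being at most the sum of all
    excesses. *)
Lemma mean_leader_loss_le (c : walk S A) (a : R) : (0 < T)%N -> 0 <= a ->
  is_cycle N cls s1 c ->
  \sum_(t < T) mean_step_loss t <=
  cycle_loss N loss c T + #|S|.+1%:R * a
  + #|noise_index S A|%:R * (expR (- rate * a) / rate) + mean_restarts.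
Proof.
move=> T0 a0 ic.
have W0 w : 0 <= (\sum_(t < T) restart (fun t => C t w) t)%:R :> R by [].
have ex0 i w : 0 <= excess a i w by rewrite /excess le_max lexx orbT.
have L0 : 0 <= cycle_loss N loss c T.
  by apply: sumr_ge0 => t _; apply: (step_loss_ge0 N lossP).
have B0 : 0 <= cycle_loss N loss c T + #|S|.+1%:R * a by rewrite addr_ge0 // mulr_ge0.
have mE : measurable_fun setT (fun w => \sum_i excess a i w).
  exact: measurable_sum.
have Zge0 : {ae P, forall w, forall i, 0 <= Z i w}.
  apply: filter_forall => i; exists [set w | Z i w < 0]; split.
  - by apply: measurable_lt.
  - rewrite -(exponential_negative (expZ i)) /distribution /pushforward.
    by congr (P _); apply/seteqP; split => w /=; rewrite in_itv.
  - by move=> w /= /negP; rewrite -ltNge.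
rewrite -lee_fin -integral_leader_loss.
apply: (@le_trans _ _ (\int[P]_w (((cycle_loss N loss c T + #|S|.+1%:R * a)%:E
    + (\sum_i excess a i w)%:E) + (\sum_(t < T) restart (fun t => C t w) t)%:R%:E))%E).
  apply: ae_ge0_le_integral => //.
  - by move=> w _; rewrite lee_fin; apply: sumr_ge0 => t _; exact: (step_loss_ge0 N lossP).
  - apply/measurable_EFinP; apply: measurable_sum => t; exact: measurable_step_loss.
  - by move=> w _; rewrite -!EFinD lee_fin addr_ge0 // addr_ge0 // sumr_ge0.
  - apply: emeasurable_funD; last exact/measurable_EFinP/measurable_restarts.
    by apply: emeasurable_funD => //; exact/measurable_EFinP.
  apply: filterS Zge0 => w Zw _; rewrite -!EFinD lee_fin.
  have := leader_loss_le lossP (run w) T0 ic.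
  have := perturbation_le w (C 0%N w) a0.
  have : 0 <= perturbation N (fun i => Z i w) c by apply: sumr_ge0.
  rewrite /=; lra.
rewrite ge0_integralD //; last 3 first.
- by move=> w _; rewrite -EFinD lee_fin addr_ge0 // sumr_ge0.
- by apply: emeasurable_funD => //; exact/measurable_EFinP.
- exact/measurable_EFinP/measurable_restarts.
rewrite mean_restartsE // [X in (_ <= X)%E]EFinD; apply: leeD => //.
rewrite ge0_integralD //; last 2 first.
- by move=> w _; rewrite lee_fin sumr_ge0.
- exact/measurable_EFinP.
rewrite integral_cst // [X in (_ * X + _)%E](_ : _ = 1%E); last exact: probability_setT.
rewrite mule1 [X in (_ <= X)%E]EFinD; apply: leeD => //.
under eq_integral do rewrite -sumEFin.
rewrite ge0_integral_sum //; last 2 first.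
- by move=> i; exact/measurable_EFinP.
- by move=> i w _; rewrite lee_fin.
under eq_bigr do rewrite (exponential_excess rate_gt0 (expZ _) a0).
by rewrite sumEFin lee_fin sumr_const -[leLHS]mulr_natl.
Qed.

Lemma integral_learner_loss_le (m : nat) (route : S -> S -> seq A) : (0 < T)%N ->
  cyclic_classes N cls -> catching_route N cls m route -> (g %| m)%N ->
  ('E_P[fun w => learner_loss N s1 loss T m route (fun t => C t w)] <=
   (\sum_(t < T) mean_step_loss t + m%:R * mean_restarts)%:E)%E.
Proof.
move=> T0 cyc catch gm; rewrite unlock.
have l0 w : 0 <= learner_loss N s1 loss T m route (fun t => C t w).
  by apply: sumr_ge0 => t _; case/andP: (lossP (learner N s1 m route (fun t => C t w) t).1
    (next_action N m route (fun t => C t w) t (learner N s1 m route (fun t => C t w) t)) (ltn_ord t)).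
apply: (@le_trans _ _ (\int[P]_w ((\sum_(t < T) step_loss N loss (C t w) t)%:E
    + m%:R%:E * (\sum_(t < T) restart (fun t => C t w) t)%:R%:E))%E).
  apply: ge0_integral_mono => w; first by rewrite lee_fin.
  rewrite -EFinM -EFinD lee_fin; apply: (learner_loss_le cyc catch gm _ lossP) => t tT.
  by have [ld _] := run w; case: (ld t tT).
rewrite ge0_integralD //; last 3 first.
- by move=> w _; rewrite lee_fin; apply: sumr_ge0 => t _; exact: (step_loss_ge0 N lossP).
- apply/measurable_EFinP; apply: measurable_sum => t; exact: measurable_step_loss.
- by apply: measurable_funeM; apply/measurable_EFinP; exact: measurable_restarts.
rewrite integral_leader_loss ge0_integralZl_EFin //; last first.
  by apply/measurable_EFinP; exact: measurable_restarts.
by rewrite mean_restartsE // EFinD EFinM.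
Qed.

End Expectations.

(** * The choice of the rate *)

(** From [1 - 1 / 2 <= expR (- (1 / 2))]. Keeps the logarithm away from 0, so that additive
    constants can be absorbed. *)
Lemma ln_nat_ge_half (R : realType) (k : nat) : (1 < k)%N -> 1 / 2 <= ln k%:R :> R.
Proof.
move=> k1; have e2 : expR (1 / 2) <= 2 :> R.
  have := expR_ge1Dx (- (1 / 2) : R); rewrite expRN.
  have := expR_gt0 (1 / 2 : R) => e0 le.
  have : 1 / 2 * expR (1 / 2) <= (expR (1 / 2))^-1 * expR (1 / 2) :> R.
    by apply: ler_wpM2r; [exact: ltW|lra].
  by rewrite mulVf ?gt_eqF //; lra.
rewrite -[leLHS]expRK ler_ln ?posrE ?expR_gt0 ?ltr0n ?(ltnW k1) //.
by apply: le_trans e2 _; rewrite ler_nat.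
Qed.

Section RateBounds.
Context {R : realType} {S A : finType}.
Variables (N : S -> A -> S) (g : nat) (cls : S -> 'I_g) (s1 : S) (T : nat).
Variable loss : nat -> S -> A -> R.
Let Lam := best_cycle_loss N s1 loss T cls.
Let logSA : R := ln (#|S| * #|A|)%:R.
Let rate := fpl_rate N s1 loss T cls.
Hypotheses (Lam_ge0 : 0 <= Lam) (logSA_gt0 : 0 < logSA).

Let S_gt0 : 0 < #|S|%:R :> R.
Proof. by rewrite ltr0n; apply/card_gt0P; exists s1. Qed.

Lemma fpl_rate_gt0 : 0 < rate.
Proof.
rewrite /rate /fpl_rate -/Lam -/logSA.
case: eqP => [_|/eqP L0]; first by rewrite divr_gt0 ?mulr_gt0.
by rewrite lt_min sqrtr_gt0 !divr_gt0 ?mulr_gt0 // lt_neqAle eq_sym L0.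
Qed.

Lemma fpl_rate_le : 4 * #|S|%:R * rate <= 1.
Proof.
have : rate <= 1 / (4 * #|S|%:R).
  by rewrite /rate /fpl_rate -/Lam; case: eqP => // _; rewrite ge_min lexx orbT.
by rewrite ler_pdivlMr ?mulr_gt0 // mulrC.
Qed.

Let sqrtE : Lam != 0 -> Num.sqrt (logSA / Lam) * Lam = Num.sqrt (Lam * logSA).
Proof.
move=> L0; rewrite -{2}[Lam]ger0_norm // -sqrtr_sqr -sqrtrM.
  by congr Num.sqrt; field.
by rewrite divr_ge0 // ltW.
Qed.

Lemma fpl_rate_mul_le : rate * Lam <= Num.sqrt (Lam * logSA).
Proof.
have [L0|L0] := eqVneq Lam 0; first by rewrite L0 mulr0 sqrtr_ge0.
rewrite -sqrtE //; apply: ler_wpM2r => //.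
by rewrite /rate /fpl_rate -/Lam (negbTE L0) ge_min lexx.
Qed.

(** The two arguments of the maximum match the two arguments of the minimum defining the rate;
    [Lam = 0] belongs to the capped case. *)
Lemma fpl_rate_div_le :
  logSA / rate <= Num.max (Num.sqrt (Lam * logSA)) (4 * #|S|%:R * logSA).
Proof.
have r0 := fpl_rate_gt0; rewrite ler_pdivrMr // mulrC.
have cap : 1 / (4 * #|S|%:R) * (4 * #|S|%:R * logSA) = logSA.
  by field; rewrite gt_eqF.
have [L0|L0] := eqVneq Lam 0.
  apply: (@le_trans _ _ (1 / (4 * #|S|%:R) * (4 * #|S|%:R * logSA))); first by rewrite cap.
  rewrite /rate /fpl_rate -/Lam L0 eqxx; apply: ler_wpM2l.
    by rewrite divr_ge0 // mulr_ge0 // ltW.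
  by rewrite le_max lexx orbT.
rewrite /rate /fpl_rate -/Lam -/logSA (negbTE L0).
have [le|lt] := leP (Num.sqrt (logSA / Lam)) (1 / (4 * #|S|%:R)).
  apply: (@le_trans _ _ (Num.sqrt (logSA / Lam) * Num.sqrt (Lam * logSA))).
    rewrite -sqrtrM ?divr_ge0 ?(ltW logSA_gt0) //.
    have -> : logSA / Lam * (Lam * logSA) = logSA ^+ 2 by field.
    by rewrite sqrtr_sqr ger0_norm // ltW.
  by apply: ler_wpM2l; rewrite ?sqrtr_ge0 // le_max lexx.
rewrite -{1}cap; apply: ler_wpM2l; last by rewrite le_max lexx orbT.
by rewrite divr_ge0 // mulr_ge0 // ltW.
Qed.

End RateBounds.

(* f is the expected loss of the leader, e its expected number of restarts. *)
Lemma regret_bound (R : realType) (n m g L Lam lg rate f e : R) :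
  1 <= n -> 1 <= g -> 0 <= m -> m <= g * n ^+ 2 -> 1 / 2 <= lg ->
  n ^+ 2 * lg <= L -> 0 <= Lam -> Lam <= L + n ->
  0 < rate -> 4 * n * rate <= 1 ->
  rate * Lam <= Num.sqrt (Lam * lg) ->
  lg / rate <= Num.max (Num.sqrt (Lam * lg)) (4 * n * lg) ->
  0 <= f -> 0 <= e ->
  e <= 1 + (n + 1) * rate * f ->
  f <= Lam + (n + 1) * (2 * (lg / rate)) + 2 / rate + e ->
  f + m * e - L <= 122 * n ^+ 3 * g * Num.sqrt (L * lg).
Proof.
move=> n1 g1 m0 mle lg2 Lge Lam0 LamL r0 rle rLam lgr f0 e0 ele fle.
have n2 : n <= n ^+ 2 by nra.
have L0 : 0 <= L by nra.
set Y := Num.sqrt (L * lg).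
have Y0 : 0 <= Y by exact: sqrtr_ge0.
have Y2 : Y ^+ 2 = L * lg by rewrite sqr_sqrtr //; nra.
(* In the given range of [L], [(n * lg) ^+ 2 <= L * lg]. This absorbs the capped term [4 * n * lg]
   into [Y]. *)
have Yn : n * lg <= Y.
  rewrite -(@ler_pXn2r _ 2) ?nnegrE //; last by nra.
  by rewrite Y2; nra.
have Lam3 : Lam <= 3 * L by nra.
have sLam : Num.sqrt (Lam * lg) <= 2 * Y.
  rewrite -(@ler_pXn2r _ 2) ?nnegrE ?sqrtr_ge0 //; last by nra.
  rewrite sqr_sqrtr; last by nra.
  by rewrite exprMn Y2; nra.
have lgY : lg / rate <= 4 * Y.
  apply: le_trans lgr _; rewrite ge_max; apply/andP; split; nra.
have rate2 : 2 / rate <= 4 * (lg / rate).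
  rewrite mulrA ler_pM2r ?invr_gt0 //; lra.
have lr0 : 0 <= lg / rate by rewrite divr_ge0 ?ltW //; nra.
(* [32 = 8 * 4]: the noise terms amount to at most [8 * n] times [lg / rate], which is at most
   [4 * Y]. *)
set b := Lam + 32 * (n * Y).
have fb : f <= b + e.
  rewrite /b; have : (n + 1) * (2 * (lg / rate)) + 2 / rate <= 8 * (n * (lg / rate)) by nra.
  have : n * (lg / rate) <= n * (4 * Y) by apply: ler_wpM2l; nra.
  nra.
(* The bounds on [f] and [e] refer to each other; the cap on [rate] keeps the feedback factor at
   most [1 / 2]. *)
have x2 : (n + 1) * rate <= 1 / 2 by nra.
have b0 : 0 <= b by rewrite /b; nra.
have f2 : f <= 2 * (b + 1).
  have : (n + 1) * rate * f <= 1 / 2 * f by apply: ler_wpM2r.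
  lra.
have nY0 : 0 <= n * Y by rewrite mulr_ge0 //; lra.
have e1 : e <= 1 + 4 * n * rate * (b + 1).
  apply: le_trans ele _; rewrite lerD2l.
  apply: (@le_trans _ _ ((n + 1) * rate * (2 * (b + 1)))).
    by apply: ler_wpM2l => //; nra.
  rewrite mulrA; apply: ler_wpM2r; nra.
have rb : 4 * n * rate * (b + 1) <= 40 * (n * Y) + 1.
  rewrite /b; have : n * (rate * Lam) <= n * (2 * Y).
    by apply: ler_wpM2l; [lra|exact: le_trans rLam sLam].
  have : 4 * n * rate * (32 * (n * Y)) <= 1 * (32 * (n * Y)) by apply: ler_wpM2r; lra.
  lra.
have Y12 : 1 / 2 <= n * Y by nra.
(* The summands 1 of [e1] and [rb] are at most [2 * (n * Y)] each. *)
have e44 : e <= 44 * (n * Y) by lra.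
have n3 : n * Y <= n ^+ 3 * g * Y.
  apply: ler_wpM2r => //; nra.
have me : m * e <= g * n ^+ 2 * (44 * (n * Y)) by apply: ler_pM.
have -> : 122 * n ^+ 3 * g * Y = 122 * (n ^+ 3 * g * Y) by ring.
have me' : g * n ^+ 2 * (44 * (n * Y)) = 44 * (n ^+ 3 * g * Y) by ring.
have nY : n <= 2 * (n * Y) by nra.
(* [122 = 2 + 32 + 44 + 44], for [Lam - L <= n], the noise, [e] and [m * e]. *)
rewrite /b in fb; lra.
Qed.

(** * Assembling the regret bound *)

Lemma best_policy_loss_ge (R : realType) (S A : finType) (N : S -> A -> S)
    (s1 : S) (loss : nat -> S -> A -> R) (T : nat) (a0 : A) (x : R) :
  (forall p, x <= policy_loss N s1 loss T p) -> x <= best_policy_loss N s1 loss T.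
Proof.
move=> le; apply: lb_le_inf => [|_ [p _ <-] //].
by exists (policy_loss N s1 loss T [ffun=> a0]), [ffun=> a0].
Qed.

Theorem theorem4p5 (R : realType) :
  exists K : R, 0 < K /\
  forall (S A : finType) (N : S -> A -> S) (gamma : nat) (cls : S -> 'I_gamma)
    (d : nat) (s1 : S) (T : nat) (loss : nat -> S -> A -> R)
    (route : S -> S -> seq A)
    (disp : measure_display) (Omega : measurableType disp)
    (P : probability Omega R)
    (Z : noise_index S A -> {RV P >-> R})
    (C : nat -> Omega -> walk S A),
  communicating N ->
  graph_period N gamma ->
  cyclic_classes N cls ->
  critical_length N cls d ->
  (forall t s a, (t < T)%N -> 0 <= loss t s a <= 1) ->
  catching_route N cls (gamma * d)%N route ->
  independent_RVs Z ->
  (forall i, exponential_RV (fpl_rate N s1 loss T cls) (Z i)) ->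
  (forall t c, (t < T)%N -> measurable [set w | C t w = c]) ->
  (forall w, fpl_run N s1 loss T cls (fun i => Z i w) (fun t => C t w)) ->
  let Lstar := best_policy_loss N s1 loss T in
  let logSA := ln (#|S| * #|A|)%:R in
  (* range of Lstar in which the O-bound is asserted *)
  (#|S| ^ 2)%:R * logSA <= Lstar ->
  ('E_P[fun w => learner_loss N s1 loss T (gamma * d) route (fun t => C t w)]
     - Lstar%:E
   <= (K * (#|S| ^ 3)%:R * gamma%:R * Num.sqrt (Lstar * logSA))%:E)%E.
Proof.
exists 122; split; first by [].
move=> S A N gamma cls d s1 T loss route disp Omega P Z C com per cyc crit lossP
  catch indep expZ mC run Lstar logSA range.
(* Walks have positive length, so the walk chosen at any sample point provides an action. *)
have a0 : A := thead (tagged (C 0%N point)).2.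
have S0 : (0 < #|S|)%N by apply/card_gt0P; exists s1.
have A0 : (0 < #|A|)%N by apply/card_gt0P; exists a0.
have gamma0 : (0 < gamma)%N by case: (cls s1) => i /=; case: (gamma).
have rhs0 : 0 <= 122 * (#|S| ^ 3)%:R * gamma%:R * Num.sqrt (Lstar * logSA).
  by rewrite !mulr_ge0 ?sqrtr_ge0.
have const x : (forall w, learner_loss N s1 loss T (gamma * d) route (fun t => C t w) = x) ->
    x <= Lstar ->
    ('E_P[fun w => learner_loss N s1 loss T (gamma * d) route (fun t => C t w)]
     - Lstar%:E <= (122 * (#|S| ^ 3)%:R * gamma%:R * Num.sqrt (Lstar * logSA))%:E)%E.
  move=> lx xL; under [fun w => learner_loss _ _ _ _ _ _ _]eq_fun do rewrite lx.
  rewrite expectation_cst -EFinB lee_fin; lra.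
have [T0|T0] := posnP T.
  apply: (const 0) => [w|]; first by rewrite /learner_loss T0 big_ord0.
  apply: best_policy_loss_ge => // p; rewrite /policy_loss T0 big_ord0 //.
(* With one state and one action the logarithm is 0 and the rate may vanish, but the learner and
   every policy then behave alike. *)
have [SA1|SA1] := leqP (#|S| * #|A|) 1.
  have [S1 A1] : #|S| = 1%N /\ #|A| = 1%N.
    have : (#|S| * #|A| == 1)%N by rewrite eqn_leq SA1 muln_gt0 S0.
    by rewrite muln_eq1 => /andP[/eqP-> /eqP->].
  have /fintype_le1P eqS : (#|S| <= 1)%N by rewrite S1.
  have /fintype_le1P eqA : (#|A| <= 1)%N by rewrite A1.
  have uniqS (x y : S) : x = y by exact: (eqS y x).
  have uniqA (x y : A) : x = y by exact: (eqA y x).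
  apply: (const (\sum_(t < T) loss t s1 a0)) => [w|].
    by apply: eq_bigr => t _; congr (loss _ _ _).
  apply: best_policy_loss_ge => // p; apply: ler_sum => t _.
  by rewrite le_eqVlt; apply/orP; left; apply/eqP; congr (loss _ _ _).
have lg : 1 / 2 <= logSA by apply: ln_nat_ge_half.
have lg0 : 0 < logSA by lra.
have Lam0 := best_cycle_loss_ge0 s1 cyc lossP a0.
have LamL := best_cycle_loss_le s1 cyc lossP a0.
have [c [ic cE]] := best_cycle_attained s1 T loss cyc a0.
have r0 := fpl_rate_gt0 Lam0 lg0.
have gm : (gamma %| gamma * d)%N by rewrite dvdn_mulr.
have dle : (d <= #|S| ^ 2)%N.
  by case: crit => _; apply; exact: reaches_class_sq.
apply: (le_trans (leeB (integral_learner_loss_le lossP indep r0 expZ mC run T0 cyc catch gm)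
  (lexx _))).
rewrite -EFinB lee_fin natrX.
(* The threshold [2 * (logSA / rate)] makes each mean excess [1 / rate] divided by the square of
   [#|S| * #|A|], and there are at most twice that square many coordinates. *)
have noise_le : #|noise_index S A|%:R *
    (expR (- fpl_rate N s1 loss T cls * (2 * (logSA / fpl_rate N s1 loss T cls))) /
     fpl_rate N s1 loss T cls) <= 2 / fpl_rate N s1 loss T cls.
  rewrite mulrA ler_pM2r ?invr_gt0 //.
  have -> : - fpl_rate N s1 loss T cls * (2 * (logSA / fpl_rate N s1 loss T cls)) =
      - (logSA + logSA) by field; rewrite gt_eqF.
  rewrite expRN ler_pdivrMr ?expR_gt0 // expRD lnK ?posrE ?ltr0n ?(ltnW SA1) //.
  rewrite -natrM -natrM ler_nat card_sum !card_prod card_ord; nia.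
have mean := mean_leader_loss_le lossP indep r0 expZ mC run T0
  (mulr_ge0 (ler0n R 2) (divr_ge0 (ltW lg0) (ltW r0))) ic.
have f0 : 0 <= \sum_(t < T) mean_step_loss N loss P C t.
  apply: sumr_ge0 => t _; apply: sumr_ge0 => c' _.
  by rewrite mulr_ge0 ?fine_ge0 // (step_loss_ge0 N lossP).
have rs := mean_restarts_le lossP indep r0 expZ mC run T0.
apply: (regret_bound _ _ _ _ lg _ Lam0 LamL r0 (fpl_rate_le N cls s1 T loss)
  (fpl_rate_mul_le Lam0 lg0) (fpl_rate_div_le Lam0 lg0) f0 (mean_restarts_ge0 _ _ _)).
- by rewrite ler1n.
- by rewrite ler1n.
- by [].
- by rewrite -natrX -natrM ler_nat leq_mul2l dle orbT.
- by rewrite -natrX.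
- by rewrite -natr1 in rs.
- rewrite -natr1 cE in mean; lra.
Qed.
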